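(* Let $N\ge 1$ be an integer, $0<\theta\le 2$, $0<\gamma<\min\{\theta,N\}$, $p>p_\gamma:=1+\frac{\theta-\gamma}{N}$, and, if $0<\theta<2$, assume in addition $\gamma<\theta(p-1)$. Then there exists a constant $c_*>0$ such that, if $\mu$ is a (measurable) function on $\mathbb{R}^N$ satisfying $$0\le\mu(x)\le c_*|x|^{-\frac{\theta-\gamma}{p-1}}\quad\text{in }\mathbb{R}^N,$$ then the Cauchy problem $$\partial_t u+(-\Delta)^{\theta/2}u=|x|^{-\gamma}u^p,\quad x\in\mathbb{R}^N,\ t>0,\qquad u(0)=\mu\ \text{ in }\mathbb{R}^N$$ possesses a local-in-time solution, i.e. a solution in $\mathbb{R}^N\times[0,T)$ for some $T>0$ (in the sense defined in the context).
   Context: $(-\Delta)^{\theta/2}$ is the fractional power of $-\Delta$ in $\mathbb{R}^N$. $G=G(x,t)$ denotes the fundamental solution (heat kernel) of $\partial_t v+(-\Delta)^{\theta/2}v=0$ in $\mathbb{R}^N\times(0,\infty)$, i.e. $G(x,t)=(2\pi)^{-N}\int_{\mathbb{R}^N}e^{ix\cdot\xi-t|\xi|^\theta}\,d\xi$. A nonnegative measurable function $\mu$ is identified with the measure $\mu(x)\,dx$. Definition of solution: for $0<T\le\infty$, a nonnegative measurable function $u$ on $\mathbb{R}^N\times(0,T)$ is a solution of the Cauchy problem in $\mathbb{R}^N\times[0,T)$ if $$\infty>u(x,t)=\int_{\mathbb{R}^N}G(x-y,t)\,d\mu(y)+\int_0^t\int_{\mathbb{R}^N}G(x-y,t-s)|y|^{-\gamma}u(y,s)^p\,dy\,ds$$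 for almost all $x\in\mathbb{R}^N$ and $0<t<T$. *)

(* Defs.v *)
From HB Require Import structures.
From mathcomp Require Import all_boot all_order all_algebra.
From mathcomp.real_closed Require Import complex.
From mathcomp Require Import all_classical all_reals all_analysis.
From mathcomp Require Import measurable_realfun.

Set Implicit Arguments.
Unset Strict Implicit.
Unset Printing Implicit Defensive.

Import Order.TTheory GRing.Theory Num.Theory.
Import numFieldNormedType.Exports.

Local Open Scope classical_set_scope.
Local Open Scope ring_scope.

(* R^N with the product (= Borel) sigma-algebra. *)
Notation eucl R N := (N.-tuple (measurableTypeR R)).

Section lebesgue_eucl.
Context {R : realType}.
Local Open Scope ereal_scope.

Definition eucl_cons N (z : measurableTypeR R * eucl R N) : eucl R N.+1 :=
  [tuple of z.1 :: z.2].

Lemma measurable_eucl_cons N : measurable_fun setT (@eucl_cons N).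
Proof. exact: (measurable_cons measurable_fst measurable_snd). Qed.

Section step.
Variables (N : nat) (m : {sigma_finite_measure set (eucl R N) -> \bar R}).

Definition lebesgue_eucl_succ : set (eucl R N.+1) -> \bar R :=
  pushforward (lebesgue_measure \x m) (@eucl_cons N).

Let succ0 : lebesgue_eucl_succ set0 = 0.
Proof. by rewrite /lebesgue_eucl_succ /pushforward preimage_set0 measure0. Qed.

Let mpre A : measurable A -> measurable (@eucl_cons N @^-1` A).
Proof.
by move=> mA; rewrite -[X in measurable X]setTI; exact: measurable_eucl_cons.
Qed.

Let succ_ge0 A : 0 <= lebesgue_eucl_succ A.
Proof. by rewrite /lebesgue_eucl_succ /pushforward; exact: measure_ge0. Qed.

Let succ_sigma_additive : semi_sigma_additive lebesgue_eucl_succ.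
Proof.
move=> F mF tF mUF; rewrite /lebesgue_eucl_succ /pushforward preimage_bigcup.
apply: measure_semi_sigma_additive.
- by move=> n; exact: mpre.
- apply/trivIsetP => /= i j _ _ ij; rewrite -preimage_setI.
  by move/trivIsetP : tF => /(_ _ _ _ _ ij) ->//; rewrite preimage_set0.
- by rewrite -preimage_bigcup; exact: mpre.
Qed.

HB.instance Definition _ := isMeasure.Build _ _ _
  lebesgue_eucl_succ succ0 succ_ge0 succ_sigma_additive.

Let succ_sigma_finite : sigma_finite setT lebesgue_eucl_succ.
Proof.
have /sigma_finiteP[F [FT ndF Foo]] := sigma_finiteT (@lebesgue_measure R).
have /sigma_finiteP[G [GT ndG Goo]] := sigma_finiteT m.
pose uncons (x : eucl R N.+1) : measurableTypeR R * eucl R N :=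
  (thead x, [tuple of behead x]).
have consK : cancel (@eucl_cons N) uncons.
  by move=> [a x]; congr pair; exact: val_inj.
have munc : measurable_fun setT uncons.
  apply/measurable_fun_pairP; split; first exact: measurable_tnth.
  exact: measurable_behead.
exists (fun n => uncons @^-1` (F n `*` G n)).
  rewrite -preimage_bigcup (_ : \bigcup_n _ = setT) ?preimage_setT//.
  rewrite -setXTT FT GT predeqE => -[x y]; split.
    by move=> [n _ []/= ? ?]; split; exists n.
  move=> [/= [n _ Fnx] [k _ Gky]]; exists (maxn n k) => //; split.
  - by move: x Fnx; exact/subsetPset/ndF/leq_maxl.
  - by move: y Gky; exact/subsetPset/ndG/leq_maxr.
move=> n; have [mF Fn] := Foo n; have [mG Gn] := Goo n; split.
  rewrite -[X in measurable X]setTI; apply: munc => //; exact: measurableX.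
rewrite /lebesgue_eucl_succ /pushforward -comp_preimage.
rewrite (_ : uncons \o _ = id); last by apply/funext => z /=; rewrite consK.
by rewrite preimage_id product_measure1E// lte_mul_pinfty// ge0_fin_numE.
Qed.

HB.instance Definition _ := Measure_isSigmaFinite.Build _ _ _
  lebesgue_eucl_succ succ_sigma_finite.

End step.

Fixpoint lebesgue_eucl N : {sigma_finite_measure set (eucl R N) -> \bar R} :=
  match N with
  | 0 => \d_([tuple] : eucl R 0)
  | N'.+1 => lebesgue_eucl_succ (lebesgue_eucl N')
  end.

Lemma lebesgue_eucl_box N (A : 'I_N -> set (measurableTypeR R)) :
  (forall i, measurable (A i)) ->
  lebesgue_eucl N [set x : eucl R N | forall i, A i (tnth x i)]
    = \prod_(i < N) lebesgue_measure (A i).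
Proof.
elim: N A => [|N IH] A mA.
  by rewrite big_ord0 /= diracE mem_set// => -[].
rewrite big_ord_recl -(IH (fun i => A (lift ord0 i)))//=.
rewrite /lebesgue_eucl_succ /pushforward -product_measure1E//; last first.
  pose B (i : 'I_N) := (fun x : eucl R N => tnth x i) @^-1` A (lift ord0 i).
  rewrite (_ : [set _ | _] = \bigcap_(i in [set: 'I_N]) B i); last first.
    by apply/seteqP; split => x /= Ax i => [_|]; exact: Ax.
  apply: fin_bigcap_measurable => // i _.
  by rewrite -[X in measurable X]setTI; exact: measurable_tnth.
congr (_ _); apply/seteqP; split => -[a x] /=.
  move=> Ax; split; first by have := Ax ord0.
  by move=> i; have := Ax (lift ord0 i); rewrite tnthS.
move=> [Aa Ax] i; case: (unliftP ord0 i) => [j|] ->; last exact: Aa.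
by rewrite tnthS; exact: Ax.
Qed.

End lebesgue_eucl.

Section euclidean.
Context {R : realType} {N : nat}.
Implicit Types x y : eucl R N.

Definition eucl_sub x y : eucl R N := [tuple tnth x i - tnth y i | i < N].

Definition eucl_dot x y : R := \sum_(i < N) tnth x i * tnth y i.

Definition eucl_norm x : R := Num.sqrt (eucl_dot x x).

(* |x|^-a for a > 0, with value +oo at the origin, whereas powR 0 (- a) = 0. *)
Definition norm_npow (a : R) x : \bar R :=
  if eucl_norm x == 0 then +oo%E else (eucl_norm x `^ (- a))%:E.

End euclidean.

(* measurability with respect to the completion of the sigma-algebra under mu *)
Definition completed_measurable_fun d (T : measurableType d) (R : realType)
    (mu : set T -> \bar R) (D : set T) (f : T -> \bar R) : Prop :=
  measurable_fun (D : set (g_sigma_algebraType (completed_algebra_gen mu))) f.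

Section heat_kernel.
Context {R : realType}.
Local Open Scope complex_scope.

Definition complex_exp (z : R[i]) : R[i] :=
  (expR (complex.Re z))%:C * (cos (complex.Im z) +i* sin (complex.Im z)).

Definition complex_integral d (T : measurableType d)
    (mu : {measure set T -> \bar R}) (f : T -> R[i]) : R[i] :=
  (\int[mu]_x complex.Re (f x)) +i* (\int[mu]_x complex.Im (f x)).

Definition heat_kernelC N (theta : R) (x : eucl R N) (t : R) : R[i] :=
  ((2 * pi) ^- N)%:C *
  complex_integral (lebesgue_eucl N) (fun xi =>
    complex_exp ((0 +i* 1) * (eucl_dot x xi)%:C - (t * eucl_norm xi `^ theta)%:C)).

(* The integral above is real, its imaginary part being the integral of an odd
   function. *)
Definition heat_kernel N (theta : R) (x : eucl R N) (t : R) : R :=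
  complex.Re (heat_kernelC theta x t).

End heat_kernel.

Section solution.
Context {R : realType} {N : nat}.
Local Open Scope ereal_scope.

Local Notation leb := (lebesgue_eucl N : set (eucl R N) -> \bar R).

(* the measure f(x) dx *)
Definition density_measure (f : eucl R N -> \bar R) : set (eucl R N) -> \bar R :=
  fun A => \int[leb]_(x in A) f x.

Definition space_time (T : \bar R) : set (eucl R N * measurableTypeR R)%type :=
  [set z | (0 < z.2)%R /\ z.2%:E < T].

(* Measurability of u is Lebesgue measurability.  The integrals are taken
   against the Borel restriction of Lebesgue measure: for a nonnegative f,
   \int is the supremum of the integrals of the Borel simple functions below f,
   which is the Lebesgue integral as soon as f is Lebesgue measurable. *)
Definition is_solution (theta gamma p : R) (mu : set (eucl R N) -> \bar R)
    (T : \bar R) (u : (eucl R N * measurableTypeR R)%type -> \bar R) : Prop :=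
  [/\ completed_measurable_fun (leb \x @lebesgue_measure R) (space_time T) u,
      forall z, space_time T z -> 0 <= u z &
      {ae (leb \x @lebesgue_measure R), forall z, space_time T z ->
        u z < +oo /\
        u z = \int[mu]_y (heat_kernel theta (eucl_sub z.1 y) z.2)%:E
            + \int[@lebesgue_measure R]_(s in `]0%R, z.2[) \int[leb]_y
                ((heat_kernel theta (eucl_sub z.1 y) (z.2 - s))%:E
                 * norm_npow gamma y * poweR (u (y, s)) p)}].

End solution.

(* Main.v *)
(* Write [alpha = theta / 2], [a = (theta - gamma) / (p - 1)] and let G be the
   heat kernel.

   Kernel.  The only facts needed about G are [0 <= G], [\int G(x - y, t) dy <= 1],
   [G(x, t) <= C |x|^-N] and [G(x, t) <= C t^(-N/theta)].  The first three hold,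
   with constants independent of s, for the Gaussians whose Fourier transforms
   are [exp(- s |xi|^2)], hence for finite convex combinations of these, and they
   survive pointwise limits (dominated convergence on the Fourier side, Fatou on
   the other).  And [exp(- t l^alpha)] is such a limit: [l^alpha] is a limit of
   combinations of the functions [1 - exp(- s l)] with positive coefficients, by a
   discretized Levy-Khintchine formula.

   Equation.  Put [w(x, t) = min (|x|^-a, t^(-a/theta))].  The kernel bounds give
   [\int G(x - y, t) |y|^-b dy <= C min (|x|^-b, t^(-b/theta))] for [0 < b < N],
   whence both the heat flow of the datum and the Duhamel integral of
   [|y|^-gamma w^p] are at most a multiple of w.  So for c small the monotone
   iteration started at 0 stays below a multiple of w, and its limit is a solution
   (for all times). *)
Require Import Defs.
From HB Require Import structures.
From mathcomp Require Import all_boot all_order all_algebra.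
From mathcomp Require Import all_classical all_reals all_analysis.
From mathcomp Require Import measurable_realfun ring lra.

Set Implicit Arguments.
Unset Strict Implicit.
Unset Printing Implicit Defensive.

Import Order.TTheory GRing.Theory Num.Theory.
Import numFieldNormedType.Exports.

Local Open Scope classical_set_scope.
Local Open Scope ring_scope.

(** The exponent a is the scaling exponent, gamma + a p = a + theta, and p > p_gamma says exactly
    that a < N, so that |x|^-a is locally integrable. The bound |x|^-a alone does not close the
    iteration: it controls the source only by |y|^-(a + theta), which need not be locally
    integrable. The bound s^(-a/theta) allows any part of this singularity to be traded for one at s
    = 0: up to a constant the source is at most |y|^-b s^(-(a + theta - b)/theta) for every b
    between gamma and a + theta, and b is chosen as each region of the Duhamel integral requires.
    For the kernel, |x|^-N is weaker than the true decay, but it is scale invariant: it holds with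
    one constant for all Gaussians of mass one, hence for arbitrary mixtures of them. It is also
    just enough: it is used on |y| < |x|/2, where |x - y| is at least |x|/2, and there |x|^-N times
    the integral of |y|^-b is of order |x|^-b. *)

(** * One-dimensional Gaussians and their Fourier transform *)

Section gauss1.
Context {R : realType}.
Implicit Types tau phi x a : R.
Local Notation leb1 := (@lebesgue_measure R).

(** The fundamental theorem of calculus on growing intervals, then dominated convergence with |h|.
    It serves as integration by parts on the whole line in [fourier_ode]. *)
Lemma integral_derive_eq0 (H h : R -> R) :
  (forall x, is_derive x 1 H (h x)) -> continuous h ->
  leb1.-integrable setT (EFin \o h) ->
  H n%:R @[n --> \oo] --> (0 : R) -> H (- n%:R) @[n --> \oo] --> (0 : R) ->
  (\int[leb1]_x (h x)%:E = 0)%E.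
Proof.
move=> dH ch ih Hp Hm.
have cH : continuous H.
  by move=> x; apply/differentiable_continuous/derivable1_diffP; case: (dH x).
(* [n.+1] keeps every interval nondegenerate, as the fundamental theorem requires. *)
pose D n := `[- n.+1%:R, n.+1%:R]%classic : set R.
pose f n := (EFin \o h) \_ (D n).
have mh : measurable_fun setT (EFin \o h) by case/integrableP: ih.
have mf n : measurable_fun setT (f n).
  apply/(measurable_restrictT _ _).1; first exact: measurable_itv.
  exact: measurable_funTS.
have [] := @dominated_convergence _ _ _ leb1 setT measurableT f (EFin \o h)
  (abse \o (EFin \o h)) mf mh.
- apply: aeW => x _; apply: cvg_near_cst; near=> n.
  rewrite /f patchE ifT// inE /D /= in_itv /=.
  have xn : `|x| <= n.+1%:R.
    apply: (@le_trans _ _ n%:R); last by rewrite ler_nat.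
    by near: n; exact: nbhs_infty_ger.
    by rewrite -ler_norml.
- exact: integrable_abse.
- apply: aeW => x n _ /=; rewrite /f patchE; case: ifPn => // _.
  by rewrite abse0.
move=> _ _ cv.
have E n : (\int[leb1]_x f n x = (H n.+1%:R)%:E - (H (- n.+1%:R))%:E)%E.
  rewrite /f -integral_mkcond; apply: continuous_FTC2.
  - by rewrite (lt_trans (y:=0))// ?oppr_lt0 ?ltr0n.
  - exact: continuous_subspaceT.
  - split => //.
    + by apply: cvg_at_right_filter; exact: cH.
    + by apply: cvg_at_left_filter; exact: cH.
  - by move=> x _; rewrite derive1E; case: (dH x).
have cv2 : (\int[leb1]_x f n x @[n --> \oo] --> (0 : R)%:E)%E.
  under eq_fun do rewrite E -EFinB.
  apply: cvg_EFin; first exact: nearW.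
  rewrite -[X in _ --> X](subr0 (0 : R)).
  have sh (u : R^nat) : u @ \oo --> (0:R) -> u n.+1 @[n --> \oo] --> (0:R).
    by move=> uu; rewrite (cvg_shiftS u).
  by apply: cvgB; [exact: (sh (fun n => H n%:R))|exact: (sh (fun n => H (- n%:R)))].
exact: (cvg_unique (@ereal_hausdorff R) cv cv2).
Unshelve. all: by end_near. Qed.

(** The variance is 1 / (2 tau); mass and integrability of Gaussians are then those of the normal
    law. *)
Lemma normal_pdf_gauss tau (m x : R) : 0 < tau ->
  expR (- (tau * (x - m) ^+ 2))
  = Num.sqrt (pi / tau) * normal_pdf m (Num.sqrt (2 * tau)^-1) x.
Proof.
move=> t0; have s0 : 0 < (2 * tau)^-1 by rewrite invr_gt0 mulr_gt0.
have [s1 s2] : Num.sqrt (2 * tau)^-1 != 0 /\ Num.sqrt (2 * tau)^-1 ^+ 2 = (2 * tau)^-1.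
  by rewrite gt_eqF ?sqrtr_gt0// sqr_sqrtr// ltW.
rewrite /normal_pdf (negbTE s1) /normal_peak /normal_fun s2.
have -> : (2 * tau)^-1 * pi *+ 2 = pi / tau by field; rewrite gt_eqF.
rewrite mulVKf ?gt_eqF// ?sqrtr_gt0 ?divr_gt0 ?pi_gt0//.
by congr expR; field; rewrite gt_eqF.
Qed.

Lemma integral_gauss tau (m : R) : 0 < tau ->
  (\int[leb1]_x (expR (- (tau * (x - m) ^+ 2)))%:E = (Num.sqrt (pi / tau))%:E)%E.
Proof.
move=> t0; under eq_integral do rewrite normal_pdf_gauss// EFinM.
rewrite integralZl//; last exact: integrable_normal_pdf.
by rewrite integral_normal_pdf mule1.
Qed.

Lemma integrable_gauss tau : 0 < tau ->
  leb1.-integrable setT (fun x => (expR (- (tau * x ^+ 2)))%:E).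
Proof.
move=> t0; have := @integrable_normal_pdf R 0 (Num.sqrt (2 * tau)^-1).
move/(integrableZl measurableT (Num.sqrt (pi / tau))).
by apply: eq_integrable => // x _; rewrite -EFinM -normal_pdf_gauss// subr0.
Qed.

Lemma integrable_id_gauss tau : 0 < tau ->
  leb1.-integrable setT (fun x => (`|x| * expR (- (tau * x ^+ 2)))%:E).
Proof.
(* Half of the Gaussian absorbs |x|: with this K, |x| <= 1 + x^2 <= K (1 + tau x^2 / 2) <= K exp(tau
   x^2 / 2). *)
move=> t0; pose K := 1 + 2 / tau.
have t2 : 0 < tau / 2 by rewrite divr_gt0.
have := integrable_gauss t2.
move/(integrableZl measurableT K); apply: le_integrable => //.
  apply/measurable_EFinP; apply: measurable_funM; first exact: normr_measurable.
  do 2 apply: measurableT_comp => //.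
  exact: measurable_funM.
move=> x _; rewrite -EFinM !abse_EFin lee_fin !normrM normr_id.
rewrite !(ger0_norm (expR_ge0 _)) ger0_norm; last by rewrite addr_ge0// divr_ge0// ltW.
have -> : expR (- (tau * x ^+ 2)) = expR (- (tau / 2 * x ^+ 2)) * expR (- (tau / 2 * x ^+ 2)).
  by rewrite -expRD; congr expR; field.
rewrite mulrA ler_wpM2r ?expR_ge0// expRN ler_pdivrMr ?expR_gt0//.
have E := expR_ge1Dx (tau / 2 * x ^+ 2).
apply: (@le_trans _ _ (K * (1 + tau / 2 * x ^+ 2))); last first.
  by rewrite ler_wpM2l// addr_ge0// divr_ge0// ltW.
have -> : K * (1 + tau / 2 * x ^+ 2) = 1 + 2 / tau + tau / 2 * x ^+ 2 + x ^+ 2.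
  by rewrite /K; field; rewrite gt_eqF.
have h1 : 0 <= 2 / tau by rewrite divr_ge0// ltW.
have h2 : 0 <= tau / 2 * x ^+ 2 by rewrite mulr_ge0 ?sqr_ge0// ltW.
have : `|x| ^+ 2 = x ^+ 2 by rewrite real_normK ?num_real.
have := sqr_ge0 (`|x| - 1); nra.
Qed.

Let gs tau a : R := expR (- (tau * a ^+ 2)).

Let measurable_gs tau : measurable_fun setT (gs tau).
Proof.
by do 2 apply: measurableT_comp => //; exact: measurable_funM.
Qed.

Let cvg_gs tau : 0 < tau -> gs tau n%:R @[n --> \oo] --> (0 : R).
Proof.
move=> t0; apply: (@squeeze_cvgr _ _ _ _ (fun=> 0) (fun n => tau^-1 * n%:R^-1)).
- near=> n; rewrite expR_ge0 /= /gs expRN -invfM lef_pV2 ?posrE ?expR_gt0//; last first.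
    by rewrite mulr_gt0// ltr0n; near: n; exact: nbhs_infty_gt.
  apply: le_trans (expR_ge1Dx _); rewrite -[leLHS]add0r lerD//.
  by rewrite ler_pM2l// -natrX ler_nat -{1}(expn1 n) leq_pexp2l//; near: n; exact: nbhs_infty_gt.
- exact: cvg_cst.
- rewrite -[X in _ --> X](mulr0 tau^-1); apply: cvgMl_tmp.
  by apply/gtr0_cvgV0; [near=> n; rewrite ltr0n; near: n; exact: nbhs_infty_gt|exact: cvgr_idn].
Unshelve. all: by end_near. Qed.

Let measurable_cos_affine phi x : measurable_fun setT (fun a => cos (phi + x * a) : R).
Proof.
apply: measurableT_comp; first by apply: continuous_measurable_fun; exact: continuous_cos.
by apply: measurable_funD => //; exact: measurable_funM.
Qed.

Let measurable_sin_affine phi x : measurable_fun setT (fun a => sin (phi + x * a) : R).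
Proof.
apply: measurableT_comp; first by apply: continuous_measurable_fun; exact: continuous_sin.
by apply: measurable_funD => //; exact: measurable_funM.
Qed.

Let norm_cos_le1 (z : R) : `|cos z| <= 1.
Proof. by rewrite ler_norml cos_geN1 cos_le1. Qed.

Let norm_sin_le1 (z : R) : `|sin z| <= 1.
Proof. by rewrite ler_norml sin_geN1 sin_le1. Qed.

Lemma integrable_cos_gauss tau phi x : 0 < tau ->
  leb1.-integrable setT (fun a => (cos (phi + x * a) * expR (- (tau * a ^+ 2)))%:E).
Proof.
move=> t0; apply: le_integrable (integrable_gauss t0) => //.
  by apply/measurable_EFinP/measurable_funM; [exact: measurable_cos_affine|exact: measurable_gs].
move=> a _; rewrite !abse_EFin lee_fin normrM ler_piMl//; exact: norm_cos_le1.
Qed.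

Let integrable_idsin tau phi x : 0 < tau ->
  leb1.-integrable setT (fun a => (- a * sin (phi + x * a) * gs tau a)%:E).
Proof.
move=> t0; apply: le_integrable (integrable_id_gauss t0) => //.
  apply/measurable_EFinP; apply: measurable_funM; last exact: measurable_gs.
  by apply: measurable_funM => //; exact: measurable_sin_affine.
move=> a _; rewrite !abse_EFin lee_fin !normrM normrN normr_id ler_wpM2r//.
by rewrite ler_piMr//; exact: norm_sin_le1.
Qed.

Let is_derive_f tau phi x a :
  is_derive x 1 (fun x => cos (phi + x * a) * gs tau a) (- a * sin (phi + x * a) * gs tau a).
Proof.
apply: is_derive_eq.
rewrite /GRing.scale /=; ring.
Qed.

Let is_derive_H tau phi x a :
  is_derive a 1 (fun a => sin (phi + x * a) * gs tau a)
    (x * (cos (phi + x * a) * gs tau a) + 2 * tau * (- a * sin (phi + x * a) * gs tau a)).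
Proof.
rewrite /gs; apply: is_derive_eq.
rewrite /GRing.scale /=; ring.
Qed.

(* Integrating the derivative of [sin (phi + x a) exp(- tau a^2)] in a. *)
Let fourier_ode tau phi x : 0 < tau ->
  x * (\int[leb1]_a (cos (phi + x * a) * gs tau a)) +
  2 * tau * (\int[leb1]_a (- a * sin (phi + x * a) * gs tau a)) = 0.
Proof.
move=> t0; have i1 := integrable_cos_gauss phi x t0; have i2 := integrable_idsin phi x t0.
rewrite -RintegralZl// -RintegralZl// -RintegralD//=; [|exact: (integrableZl measurableT _ i1)|exact: (integrableZl measurableT _ i2)].
rewrite /Rintegral (integral_derive_eq0 (fun a => is_derive_H tau phi x a))//.
- move=> a; have d := is_derive_H tau phi x.
  have cgs : {for a, continuous (gs tau)}.
    apply: continuous_comp; last exact: continuous_expR.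
    by apply: cvgN; apply: cvgMl_tmp; exact: exprn_continuous.
  have caff : {for a, continuous (fun a => phi + x * a)}.
    by apply: cvgD; [exact: cvg_cst|apply: cvgMl_tmp; exact: cvg_id].
  apply: cvgD; apply: cvgMl_tmp; apply: cvgM => //.
    by apply: continuous_comp caff _; exact: continuous_cos.
  apply: cvgM; first by apply: cvgN; exact: cvg_id.
  by apply: continuous_comp caff _; exact: continuous_sin.
- have := integrableD measurableT (integrableZl measurableT x i1) (integrableZl measurableT (2 * tau) i2).
  by apply: eq_integrable => // a _; rewrite /= -!EFinM -EFinD.
- apply: (@squeeze_cvgr _ _ _ _ (fun n => - gs tau n%:R) (fun n => gs tau n%:R)); last exact: cvg_gs.
  + by apply: nearW => n; rewrite -ler_norml normrM (ger0_norm (expR_ge0 _)) ler_piMl ?expR_ge0.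
  + by rewrite -oppr0; apply: cvgN; exact: cvg_gs.
- apply: (@squeeze_cvgr _ _ _ _ (fun n => - gs tau n%:R) (fun n => gs tau n%:R)); last exact: cvg_gs.
  + apply: nearW => n; rewrite -ler_norml normrM (ger0_norm (expR_ge0 _)).
    by rewrite /gs sqrrN ler_piMl ?expR_ge0.
  + by rewrite -oppr0; apply: cvgN; exact: cvg_gs.
Qed.

(* The phase phi lets the induction on the dimension of [fourier_eucl_gauss] be
   carried out with cosines only. *)
Lemma fourier_gauss tau phi x : 0 < tau ->
  \int[leb1]_a (cos (phi + x * a) * expR (- (tau * a ^+ 2)))
  = cos phi * Num.sqrt (pi / tau) * expR (- (x ^+ 2 / (4 * tau))).
Proof.
move=> t0; pose F x := \int[leb1]_a (cos (phi + x * a) * gs tau a).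
pose F' x := \int[leb1]_a (- a * sin (phi + x * a) * gs tau a).
have d1 y a : partial1of2 (fun x a => cos (phi + x * a) * gs tau a) y a
    = - a * sin (phi + y * a) * gs tau a.
  by rewrite partial1of2E; have [_ ->] := is_derive_f tau phi y a.
have dF (y : R) : is_derive y 1 F (F' y).
  have yI : `]y - 1, y + 1[%classic y by rewrite /= in_itv /= ltrBlDr ltrDl ltr01.
  have gub z a : `]y - 1, y + 1[%classic z -> setT a ->
      `|partial1of2 (fun x a => cos (phi + x * a) * gs tau a) z a| <= `|a| * gs tau a.
    move=> _ _; rewrite d1 !normrM normrN (ger0_norm (expR_ge0 _)) ler_wpM2r ?expR_ge0//.
    by rewrite ler_piMr//; exact: norm_sin_le1.
  have g0 a : 0 <= `|a| * gs tau a by rewrite mulr_ge0 ?expR_ge0.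
  have df z a : `]y - 1, y + 1[%classic z -> setT a ->
      derivable (fun x => cos (phi + x * a) * gs tau a) z 1.
    by move=> _ _; have [] := is_derive_f tau phi z a.
  have intf z : `]y - 1, y + 1[%classic z -> leb1.-integrable setT
      (EFin \o (fun a => cos (phi + z * a) * gs tau a)).
    by move=> _; exact: integrable_cos_gauss.
  split.
    exact: (derivable_under_integral measurableT yI intf df g0 (integrable_id_gauss t0) gub).
  rewrite -derive1E (differentiation_under_integral measurableT yI intf df g0 (integrable_id_gauss t0) gub).
  by apply: eq_Rintegral => a _; rewrite d1.
(* Integrating factor: [fourier_ode] reads F' = - y F / (2 tau), so E is constant and its value is
   found at y = 0. *)
pose E y := F y * expR (y ^+ 2 / (4 * tau)).
have dE (y : R) : is_derive y 1 E 0.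
  have := fourier_ode phi y t0; rewrite -/(F y) -/(F' y) => ode.
  apply: is_derive_eq; rewrite /GRing.scale /=.
  have -> : F' y = - (y * F y) / (2 * tau).
    apply: (mulfI (_ : 2 * tau != 0)); first by rewrite gt_eqF// mulr_gt0.
    rewrite mulrCA mulfV ?mulr1 ?gt_eqF ?mulr_gt0//.
    by apply/eqP; rewrite -addr_eq0 addrC ode.
  by field; rewrite gt_eqF.
have := is_derive_0_is_cst x 0 dE; rewrite /E expr0n /= mul0r expR0 mulr1.
move=> EF; rewrite expRN.
apply: (mulIf (lt0r_neq0 (expR_gt0 (x ^+ 2 / (4 * tau))))).
rewrite mulfVK ?gt_eqF ?expR_gt0//. rewrite [LHS]EF /F.
under eq_Rintegral do rewrite mul0r addr0.
have := integrable_gauss t0 => ig; rewrite RintegralZl//; congr (_ * _).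
rewrite /Rintegral -[RHS]/(fine (Num.sqrt (pi / tau))%:E) -(integral_gauss 0 t0).
by congr fine; apply: eq_integral => a _; rewrite subr0.
Qed.

End gauss1.

(** * Gaussian integrals on R^N *)

Section eucl.
Context {R : realType}.
Local Notation leb1 := (@lebesgue_measure R).
Local Notation leb N := (@lebesgue_eucl R N).

Lemma eucl_dot_cons N (a b : R) (x y : eucl R N) :
  eucl_dot (eucl_cons (a, x)) (eucl_cons (b, y)) = a * b + eucl_dot x y.
Proof.
rewrite /eucl_dot big_ord_recl /=; congr (_ + _).
by apply: eq_bigr => i _; rewrite !tnthS.
Qed.

Lemma eucl_sub_cons N (a b : R) (x y : eucl R N) :
  eucl_sub (eucl_cons (a, x)) (eucl_cons (b, y)) = eucl_cons (a - b, eucl_sub x y).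
Proof.
apply: eq_from_tnth => i; rewrite tnth_mktuple.
case: (unliftP ord0 i) => [j|] ->; last by [].
by rewrite !tnthS tnth_mktuple.
Qed.

Lemma eucl_dot_ge0 N (x : eucl R N) : 0 <= eucl_dot x x.
Proof. by apply: sumr_ge0 => i _; rewrite -expr2 sqr_ge0. Qed.

Lemma eucl_norm_ge0 N (x : eucl R N) : 0 <= eucl_norm x.
Proof. exact: sqrtr_ge0. Qed.

Lemma sqr_eucl_norm N (x : eucl R N) : eucl_norm x ^+ 2 = eucl_dot x x.
Proof. by rewrite sqr_sqrtr// eucl_dot_ge0. Qed.

Lemma measurable_eucl_dot N d (T : measurableType d) (f g : T -> eucl R N) :
  measurable_fun setT f -> measurable_fun setT g ->
  measurable_fun setT (fun z => eucl_dot (f z) (g z)).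
Proof.
move=> mf mg; apply: measurable_sum => i.
by apply: measurable_funM; apply: measurableT_comp (measurable_tnth i) _.
Qed.

Lemma measurable_eucl_norm N : measurable_fun setT (@eucl_norm R N).
Proof.
apply: measurableT_comp; last exact: measurable_eucl_dot.
by apply: continuous_measurable_fun; exact: sqrt_continuous.
Qed.

Lemma measurable_eucl_sub N d (T : measurableType d) (f g : T -> eucl R N) :
  measurable_fun setT f -> measurable_fun setT g ->
  measurable_fun setT (fun z => eucl_sub (f z) (g z)).
Proof.
move=> mf mg; apply/measurable_fun_tnthP => i /=.
rewrite (_ : _ \o _ = fun z => tnth (f z) i - tnth (g z) i); last first.
  by apply/funext => z; rewrite /= tnth_mktuple.
by apply: measurable_funB; apply: measurableT_comp (measurable_tnth i) _.
Qed.

Lemma ge0_integral_eucl_cons N (f : eucl R N.+1 -> \bar R) :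
  measurable_fun setT f -> (forall x, 0 <= f x)%E ->
  (\int[leb N.+1]_x f x = \int[leb1]_a \int[leb N]_x f (eucl_cons (a, x)))%E.
Proof.
move=> mf f0 /=; rewrite ge0_integral_pushforward//; last exact: measurable_eucl_cons.
rewrite preimage_setT fubini_tonelli1//.
  by apply: measurableT_comp => //; exact: measurable_eucl_cons.
by move=> x; exact: f0.
Qed.

Lemma integral_eucl_cons N (f : eucl R N.+1 -> \bar R) :
  (leb N.+1).-integrable setT f ->
  (\int[leb N.+1]_x f x = \int[leb1]_a \int[leb N]_x f (eucl_cons (a, x)))%E.
Proof.
move=> /integrableP[mf fi].
have mfc : measurable_fun setT (f \o @eucl_cons R N).
  by apply: measurableT_comp => //; exact: measurable_eucl_cons.
have ifc : (leb1 \x leb N)%E.-integrable setT (f \o @eucl_cons R N).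
  apply/integrableP; split => //; move: fi => /=.
  rewrite ge0_integral_pushforward//; first exact: measurable_eucl_cons.
  exact: measurableT_comp.
rewrite /= integral_pushforward//; last exact: measurable_eucl_cons.
by rewrite preimage_setT -integral12_prod_meas1.
Qed.

Lemma measurable_eucl_gauss N (tau : R) (x : eucl R N) :
  measurable_fun setT
    (fun y => expR (- (tau * eucl_dot (eucl_sub x y) (eucl_sub x y)))).
Proof.
do 2 apply: measurableT_comp => //; apply: measurable_funM => //.
by apply: measurable_eucl_dot; apply: measurable_eucl_sub.
Qed.

Lemma integral_eucl_gauss N (tau : R) (x : eucl R N) : 0 < tau ->
  (\int[leb N]_y (expR (- (tau * eucl_dot (eucl_sub x y) (eucl_sub x y))))%:E
   = (Num.sqrt (pi / tau) ^+ N)%:E)%E.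
Proof.
move=> t0; elim: N x => [|N IH] x.
  rewrite /= integral_dirac//; last first.
    apply/measurable_EFinP. exact: measurable_eucl_gauss.
  by rewrite diracE mem_set// mul1e /eucl_dot big_ord0 mulr0 oppr0 expR0.
rewrite ge0_integral_eucl_cons//; last by apply/measurable_EFinP; exact: measurable_eucl_gauss.
case/tupleP: x => a x.
under eq_integral => b _.
  under eq_integral => y _.
    rewrite -[[tuple of a :: x]]/(eucl_cons (a, x)) eucl_sub_cons eucl_dot_cons.
    rewrite mulrDr opprD expRD EFinM.
    over.
  rewrite ge0_integralZl//; last by apply/measurable_EFinP; exact: measurable_eucl_gauss.
  rewrite IH muleC -expr2.
  have -> : (a - b) ^+ 2 = (b - a) ^+ 2 by ring.
  over.
rewrite ge0_integralZl//; last first.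
  apply/measurable_EFinP; do 2 apply: measurableT_comp => //.
  by apply: measurable_funM => //; apply: measurable_funX; exact: measurable_funB.
by rewrite integral_gauss// -EFinM -exprSr.
Qed.

Lemma eucl_sub0 N (x : eucl R N) : eucl_sub x [tuple 0 | i < N] = x.
Proof. by apply: eq_from_tnth => i; rewrite !tnth_mktuple subr0. Qed.

Lemma eucl_dot_subC N (x y : eucl R N) :
  eucl_dot (eucl_sub x y) (eucl_sub x y) = eucl_dot (eucl_sub y x) (eucl_sub y x).
Proof. by apply: eq_bigr => i _; rewrite !tnth_mktuple; ring. Qed.

Lemma integrable_eucl_gauss N (tau : R) : 0 < tau ->
  (leb N).-integrable setT (fun y => (expR (- (tau * eucl_dot y y)))%:E).
Proof.
move=> t0.
have E y : eucl_dot (eucl_sub [tuple 0 | i < N] y) (eucl_sub [tuple 0 | i < N] y) = eucl_dot y y :> R.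
  by rewrite eucl_dot_subC eucl_sub0.
have m := @measurable_eucl_gauss N (tau : R) [tuple 0 | i < N].
under eq_fun do rewrite -E.
apply/integrableP; split; first exact/measurable_EFinP.
under eq_integral do rewrite gee0_abs//.
by rewrite integral_eucl_gauss// ltry.
Qed.

Lemma measurable_cos : measurable_fun setT (@cos R).
Proof. by apply: continuous_measurable_fun; exact: continuous_cos. Qed.

Lemma norm_cos_le1 (z : R) : `|cos z| <= 1.
Proof. by rewrite ler_norml cos_geN1 cos_le1. Qed.

Lemma integrable_cosM N (phi : R) (x : eucl R N) (f : eucl R N -> R) :
  (leb N).-integrable setT (EFin \o f) ->
  (leb N).-integrable setT (fun y => (cos (phi + eucl_dot x y) * f y)%:E).
Proof.
move=> fi; apply: (le_integrable _ _ _ fi) => //.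
  apply/measurable_EFinP; apply: measurable_funM; last by case/integrableP: fi => /measurable_EFinP.
  apply: measurableT_comp; first exact: measurable_cos.
  by apply: measurable_funD => //; exact: measurable_eucl_dot.
by move=> y _; rewrite /= lee_fin normrM ler_piMl// norm_cos_le1.
Qed.

Lemma fourier_eucl_gauss N (tau phi : R) (x : eucl R N) : 0 < tau ->
  (\int[leb N]_y (cos (phi + eucl_dot x y) * expR (- (tau * eucl_dot y y)))%:E
   = (cos phi * (Num.sqrt (pi / tau) ^+ N * expR (- (eucl_dot x x / (4 * tau)))))%:E)%E.
Proof.
move=> t0; elim: N phi x => [|N IH] phi x.
  rewrite /= integral_dirac//; last first.
    apply: (measurable_int (leb 0)); apply: integrable_cosM; exact: integrable_eucl_gauss.
  rewrite diracE mem_set// mul1e /eucl_dot !big_ord0.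
  by rewrite mul0r mulr0 !oppr0 expR0 !mulr1 addr0.
rewrite integral_eucl_cons//; last exact/integrable_cosM/integrable_eucl_gauss.
case/tupleP: x => a x.
under eq_integral => b _.
  under eq_integral => y _.
    rewrite -[[tuple of a :: x]]/(eucl_cons (a, x)) !eucl_dot_cons.
    rewrite mulrDr opprD expRD addrA mulrCA EFinM.
    over.
  rewrite integralZl//; last exact/integrable_cosM/integrable_eucl_gauss.
  rewrite IH -EFinM [X in X%:E](_ : _ = (Num.sqrt (pi / tau) ^+ N *
    expR (- (eucl_dot x x / (4 * tau)))) * (cos (phi + a * b) * expR (- (tau * b ^+ 2)))).
    rewrite EFinM.
    over.
  by rewrite mulrCA [RHS]mulrC -mulrA; congr (_ * _); rewrite mulrC.

rewrite integralZl//; last exact: integrable_cos_gauss.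
rewrite -[X in (_ * X)%E]fineK; last first.
  by apply: integrable_fin_num => //; exact: integrable_cos_gauss.
have := fourier_gauss phi a t0; rewrite /Rintegral => ->.
rewrite -EFinM -[[tuple of a :: x]]/(eucl_cons (a, x)) eucl_dot_cons; congr EFin.
rewrite -[a * a]/(a ^+ 2) (mulrDl (a ^+ 2)) opprD expRD [Num.sqrt _ ^+ N.+1]exprS; ring.
Qed.
End eucl.

(** * Dyadic bounds for power weights *)

Section dyadic.
Context {R : realType}.
Context d (T : measurableType d).
Variables (m : {measure set T -> \bar R}) (r : T -> R) (A : R) (n : nat).
Hypothesis mr : measurable_fun setT r.
Hypothesis r0 : forall x, 0 <= r x.
Hypothesis A0 : 0 <= A.
Hypothesis mball : forall rho : R, 0 < rho -> (m [set x | r x < rho]%R <= (A * rho ^+ n)%:E)%E.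

Let B rho := [set x | (r x < rho)%R].

Let measurable_B rho : measurable (B rho).
Proof. by rewrite /B -[X in measurable X]setTI; exact: (measurable_fun_ltr mr). Qed.

Lemma nneseries_geometric_le (u : nat -> R) (K q : R) :
  (forall k, 0 <= u k <= K * q ^+ k) -> 0 <= q < 1 ->
  (\sum_(0 <= k <oo) (u k)%:E <= (K / (1 - q))%:E)%E.
Proof.
move=> uK /andP[q0 q1]; apply: lime_le.
  by apply: is_cvg_nneseries => k _ _; rewrite lee_fin; case/andP: (uK k).
apply: nearW => N; rewrite sumEFin lee_fin.
apply: (@le_trans _ _ (\sum_(0 <= k < N) K * q ^+ k)).
  by apply: ler_sum => k _; case/andP: (uK k).
have K0 : 0 <= K by have /andP[/le_trans h /h] := uK 0%N; rewrite expr0 mulr1.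
have cv : series (geometric K q) @ \oo --> K / (1 - q).
  by apply: cvg_geometric_series; rewrite ger0_norm.
rewrite -(cvg_lim _ cv)//.
apply: (nondecreasing_cvgn_le (u_ := series (geometric K q))); last first.
  by apply: is_cvg_geometric_series; rewrite ger0_norm.
apply/nondecreasing_seqP => j; rewrite /series /= big_nat_recr//= lerDl mulr_ge0// exprn_ge0//.
Qed.

(** Replaces polar coordinates: f is dominated by a sum of multiples of indicators of balls whose
    contributions decay geometrically. Only the polynomial growth of the balls of r enters, so the
    same bound serves the norm on R^N and the distance |s - c| on the time axis. *)
Lemma dyadic_integral_le (f : T -> \bar R) (c rho : nat -> R) (K q : R) :
  measurable_fun setT f -> (forall x, 0 <= f x)%E ->
  (forall k, 0 <= c k) -> (forall k, 0 < rho k) -> 0 <= q < 1 ->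
  (forall x, f x <= \sum_(0 <= k <oo) (c k * \1_(B (rho k)) x)%:E)%E ->
  (forall k, c k * (A * rho k ^+ n) <= K * q ^+ k) ->
  (\int[m]_x f x <= (K / (1 - q))%:E)%E.
Proof.
move=> mf f0 c0 rho0 q01 fle cK.
have mc k : measurable_fun setT (fun x => (c k * \1_(B (rho k)) x)%:E).
  by apply/measurable_EFinP; apply: measurable_funM => //; exact: measurable_indic.
have cc0 k x : (0 <= (c k * \1_(B (rho k)) x)%:E)%E.
  by rewrite lee_fin mulr_ge0.
apply: (@le_trans _ _ (\int[m]_x \sum_(0 <= k <oo) (c k * \1_(B (rho k)) x)%:E)%E).
  apply: ge0_le_integral => //.
  by apply: (@ge0_emeasurable_sum _ _ _ _ _ xpredT) => // k x _ _; exact: cc0.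
rewrite integral_nneseries//.
apply: (@le_trans _ _ (\sum_(0 <= k <oo) (c k * (A * rho k ^+ n))%:E)%E); last first.
  apply: nneseries_geometric_le => // k; rewrite cK andbT.
  by rewrite !mulr_ge0// exprn_ge0// ltW.
apply: lee_nneseries => k _; first by move=> _; exact: integral_ge0.
under eq_integral do rewrite EFinM.
rewrite ge0_integralZl//; last 2 first.
  by apply/measurable_EFinP; exact: measurable_indic.
  by rewrite lee_fin.
rewrite integral_indic// setIT EFinM lee_wpmul2l ?lee_fin//; exact: mball.
Qed.

Lemma nneseries_term_le (u : nat -> R) k : (forall k, 0 <= u k) ->
  ((u k)%:E <= \sum_(0 <= j <oo) (u j)%:E)%E.
Proof.
move=> u0; rewrite (nneseriesD1 (n := k))//; last by move=> j _; rewrite lee_fin.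
by rewrite leeDl// nneseries_ge0// => j _ _; rewrite lee_fin.
Qed.

Lemma ler_npowR (b s t : R) : 0 <= b -> 0 < s -> s <= t -> t `^ (- b) <= s `^ (- b).
Proof.
move=> b0 s0 st; have t0 := lt_le_trans s0 st.
rewrite !powRN lef_pV2 ?posrE ?powR_gt0//.
by apply: ge0_ler_powR => //; rewrite nnegrE ltW.
Qed.

Lemma gt0_powRD (x u v : R) : 0 < x -> x `^ (u + v) = x `^ u * x `^ v.
Proof. by move=> x0; rewrite powRD//; apply/implyP => _; rewrite gt_eqF. Qed.

Lemma dyadic_small (s : R) : 0 < s < 1 -> exists k, 2 ^- k.+1 <= s < 2 ^- k.
Proof.
move=> /andP[s0 s1].
have ex : exists k, 2 ^- k.+1 <= s.
  exists (Num.trunc s^-1); rewrite -[leRHS]invrK lef_pV2 ?posrE ?exprn_gt0 ?invr_gt0//.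
  apply: ltW; apply: (lt_le_trans (truncnS_gt _)).
  by rewrite -natrX ler_nat ltnW// ltn_expl.
case: (ex_minnP ex) => k causal_kernel kmin; exists k; rewrite causal_kernel /=.
case: k causal_kernel kmin => [|k] causal_kernel kmin; first by rewrite expr0 invr1.
by rewrite ltNge; apply/negP => /kmin; rewrite ltnn.
Qed.

Lemma dyadic_big (s : R) : 1 <= s -> exists k, 2 ^+ k <= s < 2 ^+ k.+1.
Proof.
move=> s1.
have ex : exists k, s < 2 ^+ k.+1.
  exists (Num.trunc s); apply: (lt_le_trans (truncnS_gt _)).
  by rewrite -natrX ler_nat ltnW// ltn_expl.
case: (ex_minnP ex) => k causal_kernel kmin; exists k; rewrite causal_kernel andbT.
case: k causal_kernel kmin => [|k] causal_kernel kmin; first by rewrite expr0.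
by rewrite leNgt; apply/negP => /kmin; rewrite ltnn.
Qed.

(* [npow b (eucl_norm x)] is convertible to [norm_npow b x]; like the latter it is
   [+oo] at the origin, whereas [powR 0 (- b) = 0]. *)
Definition npow (b s : R) : \bar R := if s == 0 then +oo%E else (s `^ (- b))%:E.

Lemma npow_ge0 b s : (0 <= npow b s)%E.
Proof. by rewrite /npow; case: ifP => // _; rewrite lee_fin powR_ge0. Qed.

Lemma measurable_npow b : measurable_fun setT (npow b).
Proof.
apply: measurable_fun_ifT => //.
  exact: measurable_fun_eqr.
by apply/measurable_EFinP; exact: measurable_powR.
Qed.

(** On the shell rho 2^-(k+1) <= r < rho 2^-k the weight is at most (rho 2^-(k+1))^-b. Against balls
    of measure at most A (rho 2^-k)^n this gives the ratio 2^(b - n), below 1 because b < n. *)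
Lemma integral_ball_npow_le (b rho : R) : 0 <= b < n%:R -> 0 < rho ->
  (\int[m]_x ((\1_(B rho) x)%:E * npow b (r x)) <=
   (A * 2 `^ b / (1 - 2 `^ (b - n%:R)) * rho `^ (n%:R - b))%:E)%E.
Proof.
move=> /andP[b0 bn] rho0.
rewrite mulrAC; apply: (@dyadic_integral_le _ (fun k => (rho * 2 ^- k.+1) `^ (- b)) (fun k => rho * 2 ^- k)).
- apply: emeasurable_funM; first by apply/measurable_EFinP; exact: measurable_indic.
  by apply: measurableT_comp mr => //; exact: measurable_npow.
- by move=> x; rewrite mule_ge0 ?npow_ge0// lee_fin.
- by move=> k; rewrite powR_ge0.
- by move=> k; rewrite mulr_gt0// invr_gt0 exprn_gt0.
- rewrite powR_ge0 /= -opprB powRN invf_lt1 ?powR_gt0//.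
  have nb : 0 < n%:R - b by rewrite subr_gt0.
  by have := @gt0_ltr_powR R _ nb 1 2; rewrite powR1; apply; rewrite ?nnegrE ?ltr1n.
- move=> x; have t0 k : 0 <= (rho * 2 ^- k.+1) `^ (- b) * \1_(B (rho * 2 ^- k)) x.
    by rewrite mulr_ge0 ?powR_ge0.
  have rho2 k : 0 < rho * 2 ^- k by rewrite mulr_gt0// invr_gt0 exprn_gt0.
  have [rx|rx] := ltP (r x) rho; last first.
    rewrite indicE memNset ?mul0e ?nneseries_ge0// => /=; last by rewrite /B /= ltNge rx.
    by move=> k _ _; rewrite lee_fin.
  rewrite indicE mem_set// mul1e /npow; case: eqP => [rx0|/eqP rx0]; last first.
    have rxp : 0 < r x by rewrite lt_neqAle eq_sym rx0 r0.
    have /dyadic_small[k /andP[]] : 0 < r x / rho < 1.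
      by rewrite divr_gt0//= ltr_pdivrMr// mul1r.
    rewrite ler_pdivlMr// ltr_pdivrMr// => h1 h2.
    apply: (le_trans _ (nneseries_term_le k t0)).
    rewrite lee_fin indicE mem_set; last by rewrite /B /= mulrC.
    by rewrite mulr1 ler_npowR// mulrC.
  (* Where r vanishes the weight is [+oo]. Such a point lies in all the balls and every coefficient
     is at least rho^-b, so the dominating series diverges as well. *)
  rewrite leye_eq; apply/eqP/eqyP => M M0.
  pose e := rho `^ (- b); have e0 : 0 < e by rewrite powR_gt0.
  pose K := (Num.trunc (M / e)).+1.
  apply: le_trans (nneseries_lim_ge K _); last by move=> k _ _; rewrite lee_fin.
  rewrite sumEFin lee_fin.
  apply: (@le_trans _ _ (\sum_(0 <= k < K) e)).
    rewrite sumr_const_nat subn0 -mulr_natl -ler_pdivrMr// ltW//.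
    exact: truncnS_gt.
  apply: ler_sum => k _; rewrite indicE mem_set; last by rewrite /B /= rx0.
  rewrite mulr1 /e ler_npowR//.
  by rewrite ler_piMr ?(ltW rho0)// invf_le1 ?exprn_gt0// exprn_ege1// ler1n.
- move=> k; rewrite le_eqVlt; apply/orP; left; apply/eqP.
  have two j : 2 ^- j = 2 `^ (- j%:R) :> R by rewrite powR_invn.
  have twoD (u v : R) : 2 `^ (u + v) = 2 `^ u * 2 `^ v.
    exact: gt0_powRD.
  have e1 : (rho * 2 ^- k.+1) `^ (- b) = (rho `^ b)^-1 * 2 `^ (b * k.+1%:R).
    by rewrite two powRM ?powR_ge0 ?(ltW rho0)// [rho `^ _]powRN -powRrM mulrNN mulrC [_ * b]mulrC mulrC.
  have e2 : (rho * 2 ^- k) ^+ n = rho `^ n%:R * 2 `^ (- (k%:R * n%:R)).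
    by rewrite two exprMn -!powR_mulrn ?powR_ge0 ?(ltW rho0)// -powRrM mulNr.
  have e3 : (2 `^ (b - n%:R)) ^+ k = 2 `^ ((b - n%:R) * k%:R) :> R.
    by rewrite -powR_mulrn ?powR_ge0// -powRrM.
  have e4 : 2 `^ (b * k.+1%:R) * 2 `^ (- (k%:R * n%:R)) = 2 `^ b * 2 `^ ((b - n%:R) * k%:R) :> R.
    by rewrite -!twoD; congr (_ `^ _); rewrite -natr1; ring.
  have e5 : rho `^ (n%:R - b) = rho `^ n%:R * (rho `^ b)^-1.
    by rewrite gt0_powRD// powRN.
  rewrite e1 e2 e3 e5.
  transitivity (A * rho `^ n%:R * (rho `^ b)^-1 *
    (2 `^ (b * k.+1%:R) * 2 `^ (- (k%:R * n%:R)))); first by ring.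
  by rewrite e4; ring.
Qed.

Lemma integral_exp_npow_le (theta : R) : 0 < theta ->
  exists2 C, 0 <= C & forall t : R, 0 < t ->
  (\int[m]_x (expR (- (t * r x `^ theta)))%:E <= (C * t `^ (- (n%:R / theta)))%:E)%E.
Proof.
(* Since M theta >= n + 1, s^(n+1) <= (s^theta)^M <= M! exp(s^theta) for s >= 1: on the k-th shell
   the integrand is of order 2^-(k(n+1)), which beats the growth 2^(k n) of the balls by 2^-k. The
   factor 2^(n+1) in [C1] pays for enclosing the shell in the ball of index k + 1; the summand 1 in
   [C0] takes care of the central ball. *)
move=> th0; pose M := (Num.trunc (n.+1%:R / theta)).+1.
pose C0 : R := 1 + M`!%:R; pose C1 := C0 * 2 ^+ n.+1.
have C00 : 1 <= C0 by rewrite lerDl.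
exists (A * C1 / (1 - 2^-1)).
  by rewrite !mulr_ge0 ?(le_trans ler01 C00) ?exprn_ge0// invr_ge0; lra.
move=> t t0; pose rho0 := t `^ (- theta^-1).
have rho00 : 0 < rho0 by rewrite powR_gt0.
have rho0n : rho0 ^+ n = t `^ (- (n%:R / theta)).
  by rewrite -powR_mulrn ?powR_ge0// -powRrM mulNr mulrC.
have trho : t * rho0 `^ theta = 1.
  rewrite -powRrM mulNr mulVf ?gt_eqF// powR_inv1 ?ltW// mulfV ?gt_eqF//.
rewrite mulrAC; apply: (@dyadic_integral_le _ (fun k => C1 * (2 ^- k) ^+ n.+1) (fun k => rho0 * 2 ^+ k)).
- apply/measurable_EFinP; do 2 apply: measurableT_comp => //; apply: measurable_funM => //.
  exact: (measurableT_comp (measurable_powR _) mr).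
- by move=> x; rewrite lee_fin expR_ge0.
- by move=> k; rewrite !mulr_ge0 ?(le_trans ler01 C00) ?exprn_ge0.
- by move=> k; rewrite mulr_gt0// exprn_gt0.
- lra.
- move=> x; have t1 k : 0 <= C1 * (2 ^- k) ^+ n.+1 * \1_(B (rho0 * 2 ^+ k)) x.
    by rewrite !mulr_ge0 ?(le_trans ler01 C00) ?exprn_ge0.
  have [rx|rx] := ltP (r x) rho0.
    apply: (le_trans _ (nneseries_term_le 0 t1)).
    rewrite lee_fin indicE mem_set; last by rewrite /B /= expr0 mulr1.
    rewrite expr0 invr1 expr1n !mulr1; apply: (@le_trans _ _ 1).
      by rewrite -expR0 ler_expR oppr_le0 mulr_ge0 ?powR_ge0 ?ltW.
    by rewrite mulr_ege1// exprn_ege1// ler1n.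
  have /dyadic_big[k /andP[k1 k2]] : 1 <= r x / rho0 by rewrite ler_pdivlMr// mul1r.
  apply: (le_trans _ (nneseries_term_le k.+1 t1)).
  rewrite lee_fin indicE mem_set; last by rewrite /B /= mulrC -ltr_pdivrMr.
  have s1 : 1 <= r x / rho0 by rewrite ler_pdivlMr// mul1r.
  set s := r x / rho0 in k1 k2 s1.
  have s0 : 0 <= s by apply: le_trans s1.
  have -> : t * r x `^ theta = s `^ theta.
    have -> : r x = s * rho0 by rewrite mulfVK// gt_eqF.
    by rewrite powRM ?(ltW rho00)// mulrCA trho mulr1.
  have -> : C1 * (2 ^- k.+1) ^+ n.+1 = C0 * (2 ^- k) ^+ n.+1.
    rewrite /C1 -mulrA -exprMn; congr (_ * _ ^+ _).
    by rewrite [2 ^+ k.+1]exprS invfM mulrA mulfV ?mul1r.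
  apply: (@le_trans _ _ (M`!%:R * (2 ^- k) ^+ n.+1)); last first.
    by rewrite mulr1 ler_wpM2r ?exprn_ge0 ?invr_ge0 ?exprn_ge0// lerDr.
  have z1 : s ^+ n.+1 <= (s `^ theta) ^+ M.
    rewrite -!powR_mulrn ?powR_ge0// -powRrM ler_powR//.
    by rewrite mulrC -ler_pdivrMr// ltW// truncnS_gt.
  rewrite expRN exprVn -[M`!%:R]invrK -invfM lef_pV2 ?posrE ?expR_gt0//.
  have := @expR_ge1Dxn _ (s `^ theta) (Num.trunc (n.+1%:R / theta)) (powR_ge0 _ _).
  apply: le_trans; rewrite -[leLHS]add0r lerD// mulrC; apply: ler_wpM2r; first by rewrite invr_ge0.
  by apply: le_trans z1; rewrite lerXn2r ?nnegrE ?exprn_ge0.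
- move=> k; rewrite exprMn rho0n.
  have e : (2 ^- k) ^+ n.+1 * (2 ^+ k) ^+ n = 2^-1 ^+ k :> R.
    by rewrite exprS -mulrA -exprMn mulVf ?expf_neq0 ?pnatr_eq0// expr1n mulr1 exprVn.
  rewrite -e le_eqVlt; apply/orP; left; apply/eqP; ring.
Qed.
End dyadic.

(** * Positivity of the heat kernel by subordination *)

Section kernels.
Context {R : realType}.
Local Notation leb1 := (@lebesgue_measure R).
Local Notation leb N := (@lebesgue_eucl R N).

Lemma lebesgue_eucl_ball_le N (rho : R) : 0 < rho ->
  (leb N [set x | eucl_norm x < rho]%R <= (2 ^+ N * rho ^+ N)%:E)%E.
Proof.
move=> rho0; pose A (i : 'I_N) : set (measurableTypeR R) := `]- rho, rho[%classic.
have mA i : measurable (A i) by exact: measurable_itv.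
apply: (@le_trans _ _ (leb N [set x | forall i, A i (tnth x i)])).
  apply: le_measure; rewrite ?inE.
  - rewrite -[X in measurable X]setTI; apply: measurable_fun_ltr => //.
    exact: measurable_eucl_norm.
  - rewrite (_ : [set _ | _] = \bigcap_(i in [set: 'I_N]) ((fun x : eucl R N => tnth x i) @^-1` A i)); last first.
      by apply/seteqP; split => x /= Ax i => [_|]; exact: Ax.
    apply: fin_bigcap_measurable => // i _.
    by rewrite -[X in measurable X]setTI; apply: measurable_tnth.
  - move=> x /= xrho i; rewrite /A /= in_itv /= -ltr_norml.
    apply: le_lt_trans xrho; rewrite -(ler_pXn2r (n := 2)) ?nnegrE ?eucl_norm_ge0//.
    rewrite sqr_eucl_norm real_normK ?num_real// /eucl_dot (bigD1 i)//= -expr2 lerDl.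
    by apply: sumr_ge0 => j _; rewrite -expr2 sqr_ge0.
rewrite lebesgue_eucl_box//.
rewrite (eq_bigr (fun=> (2 * rho)%:E)); last first.
  move=> i _; rewrite /A lebesgue_measure_itv/= lte_fin ifT; last by lra.
  by rewrite -EFinB; congr EFin; ring.
by rewrite prodEFin prodr_const card_ord exprMn.
Qed.

Lemma lebesgue_ball_le (c rho : R) : 0 < rho ->
  (leb1 [set s | `|s - c| < rho]%R <= (2 * rho ^+ 1)%:E)%E.
Proof.
move=> rho0; rewrite (_ : [set _ | _] = `]c - rho, c + rho[%classic).
  rewrite lebesgue_measure_itv/= lte_fin ifT; last by lra.
  by rewrite -EFinB lee_fin; lra.
by apply/seteqP; split => s /=; rewrite in_itv /= ltr_distl.
Qed.

(** The symbol is a function of l = |xi|^2, so that Gaussians become exponentials in l and exp(- t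
    |xi|^theta) becomes exp(- t l^(theta/2)). *)
Definition radial_fourier N (m : R -> R) (x : eucl R N) : R :=
  (2 * pi) ^- N * \int[leb N]_y (cos (eucl_dot x y) * m (eucl_dot y y)).

(** M bounds the mass, and the constant of the |x|^-N bound is proportional to it; this makes the
    bounds additive and homogeneous, as convex combinations require. The mass is only bounded from
    above, which is what Fatou preserves. *)
Definition kernel_bounds N (K M : R) (k : eucl R N -> R) :=
  [/\ measurable_fun setT k, forall x, 0 <= k x,
      forall x, eucl_norm x ^+ N * k x <= K * M &
      forall x, (\int[leb N]_y (k (eucl_sub x y))%:E <= M%:E)%E].

(** With u = |x| / (2 sqrt s), |x|^N times the Gaussian (4 pi s)^(-N/2) exp(- u^2) equals pi^(-N/2)
    u^N exp(- u^2), and [pow_exp_le] bounds the last two factors by 1 + N!. *)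
Definition kernel_const N : R := (1 + N`!%:R) / Num.sqrt pi ^+ N.

Lemma radial_fourier_gauss N (s : R) (x : eucl R N) : 0 < s ->
  radial_fourier (fun l => expR (- (s * l))) x =
  (2 * pi) ^- N * (Num.sqrt (pi / s) ^+ N * expR (- (eucl_dot x x / (4 * s)))).
Proof.
move=> s0; rewrite /radial_fourier /Rintegral; congr (_ * _).
have := fourier_eucl_gauss 0 x s0; rewrite cos0 mul1r => E.
rewrite -[RHS]/(fine _%:E) -E; congr fine.
by apply: eq_integral => y _; rewrite add0r.
Qed.

Lemma pow_exp_le N (u : R) : 0 <= u -> u ^+ N * expR (- u ^+ 2) <= 1 + N`!%:R.
Proof.
move=> u0; rewrite expRN ler_pdivrMr ?expR_gt0//.
have e1 : 1 <= expR (u ^+ 2) by rewrite -expR0 ler_expR sqr_ge0.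
have [u1|u1] := leP u 1.
  apply: (@le_trans _ _ 1); first exact: exprn_ile1.
  by rewrite mulr_ege1// lerDl.
apply: (@le_trans _ _ ((u ^+ 2) ^+ N)).
  by rewrite lerXn2r ?nnegrE ?sqr_ge0// expr2 ler_peMl// ltW.
case: N => [|N]; first by rewrite expr0 mulr_ege1// lerDl.
have := @expR_ge1Dxn _ (u ^+ 2) N (sqr_ge0 _).
rewrite mulrDl mul1r => h.
apply: (@le_trans _ _ (N.+1`!%:R * (1 + (u ^+ 2) ^+ N.+1 / N.+1`!%:R))).
  rewrite mulrDr mulrCA mulfV ?mulr1 ?lerDr//.
by rewrite -[leLHS]add0r lerD ?(le_trans ler01 e1)// ler_wpM2l.
Qed.

Lemma kernel_bounds_gauss N (s : R) : 0 < s ->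
  kernel_bounds (kernel_const N) 1 (@radial_fourier N (fun l => expR (- (s * l)))).
Proof.
move=> s0; have p0 : 0 < 2 * pi :> R by rewrite mulr_gt0 ?pi_gt0.
split.
- rewrite (funext (fun x => radial_fourier_gauss x s0)).
  do 2 apply: measurable_funM => //.
  do 2 apply: measurableT_comp => //; apply: measurable_funM => //.
  exact: measurable_eucl_dot.
- move=> x; rewrite radial_fourier_gauss// !mulr_ge0 ?expR_ge0 ?exprn_ge0//.
  by rewrite invr_ge0 exprn_ge0// ltW.
- move=> x; rewrite radial_fourier_gauss// mulr1.
  pose u := eucl_norm x / (2 * Num.sqrt s).
  have ss : 0 < Num.sqrt s by rewrite sqrtr_gt0.
  have u0 : 0 <= u by rewrite divr_ge0 ?eucl_norm_ge0// mulr_ge0// ltW.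
  have -> : eucl_dot x x / (4 * s) = u ^+ 2.
    rewrite /u expr_div_n sqr_eucl_norm exprMn sqr_sqrtr ?ltW//.
    by congr (_ / (_ * _)); rewrite -natrX.
  have -> : eucl_norm x ^+ N * ((2 * pi) ^- N * (Num.sqrt (pi / s) ^+ N * expR (- u ^+ 2)))
     = u ^+ N * expR (- u ^+ 2) * (Num.sqrt pi)^-1 ^+ N.
    have E : eucl_norm x * (2 * pi)^-1 * Num.sqrt (pi / s) = u * (Num.sqrt pi)^-1.
      rewrite sqrtrM ?pi_ge0// sqrtrV ?ltW//.
      rewrite -[X in (2 * X)^-1](@sqr_sqrtr _ pi) ?pi_ge0// /u.
      by field; rewrite !gt_eqF// sqrtr_gt0 pi_gt0.
    transitivity ((eucl_norm x * (2 * pi)^-1 * Num.sqrt (pi / s)) ^+ N * expR (- u ^+ 2)).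
      rewrite -exprVn [RHS](_ : _ = eucl_norm x ^+ N * (2 * pi)^-1 ^+ N * Num.sqrt (pi / s) ^+ N * expR (- u ^+ 2)); last by rewrite 2!exprMn.
      by move: ((2 * pi)^-1 ^+ N) => ?; ring.
    by rewrite E exprMn; ring.
  rewrite /kernel_const -exprVn; apply: ler_wpM2r; last exact: pow_exp_le.
  by rewrite exprn_ge0// invr_ge0.
- move=> x; under eq_integral do rewrite radial_fourier_gauss// mulrA EFinM.
  have s4 : 0 < (4 * s)^-1 by rewrite invr_gt0 mulr_gt0.
  rewrite ge0_integralZl//; last 2 first.
  + apply/measurable_EFinP; under eq_fun do rewrite [_ / (4 * s)]mulrC.
    exact: measurable_eucl_gauss.
  + by rewrite lee_fin mulr_ge0 ?exprn_ge0// invr_ge0 exprn_ge0// ltW.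
  under eq_integral do rewrite [_ / (4 * s)]mulrC.
  rewrite integral_eucl_gauss// -EFinM lee_fin invrK -exprVn -!exprMn.
  rewrite exprn_ile1//.
    by rewrite !mulr_ge0// ?invr_ge0 ltW.
  rewrite -mulrA -sqrtrM; last by rewrite divr_ge0 ?pi_ge0 ?ltW.
  have -> : pi / s * (pi * (4 * s)) = (2 * pi) ^+ 2 by field; rewrite gt_eqF.
  by rewrite sqrtr_sqr (ger0_norm (ltW p0)) mulVf ?gt_eqF.
Qed.
End kernels.

(** * Positive exponential sums as symbols, and their pointwise limits *)

Section kernels.
Context {R : realType}.
Local Notation leb N := (@lebesgue_eucl R N).

(** Laplace transforms of finitely supported positive measures on [0, +oo[; the value at 0 is the
    total mass. The atom [s = 0] provides the constants, in particular the zeroth powers. *)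
Inductive expsum : (R -> R) -> Prop :=
| expsum_exp a s : 0 <= a -> 0 <= s -> expsum (fun l => a * expR (- (s * l)))
| expsum_add f g : expsum f -> expsum g -> expsum (fun l => f l + g l).

Lemma expsum_scale c f : 0 <= c -> expsum f -> expsum (fun l => c * f l).
Proof.
move=> c0; elim=> [a s a0 s0|g h _ IHg _ IHh].
  by under eq_fun do rewrite mulrA; apply: expsum_exp; rewrite ?mulr_ge0.
by under eq_fun do rewrite mulrDr; exact: expsum_add.
Qed.

(** Closure under products, hence powers, keeps the Taylor polynomials of exp(h) in the class when h
    belongs to it; see [damped_bounds_exp_expsum]. *)
Lemma expsum_mul f g : expsum f -> expsum g -> expsum (fun l => f l * g l).
Proof.
move=> + eg; elim=> [a s a0 s0|f1 f2 _ IH1 _ IH2].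
  elim: eg => [b u b0 u0|g1 g2 _ IH1 _ IH2].
    under eq_fun do rewrite mulrACA -expRD -opprD -mulrDl.
    by apply: expsum_exp; rewrite ?mulr_ge0 ?addr_ge0.
  by under eq_fun do rewrite mulrDr; exact: expsum_add.
by under eq_fun do rewrite mulrDl; exact: expsum_add.
Qed.

Lemma expsum_cst c : 0 <= c -> expsum (fun=> c).
Proof.
move=> c0; have := expsum_exp c0 (lexx 0).
by under eq_fun do rewrite mul0r oppr0 expR0 mulr1.
Qed.

Lemma expsum_sum n (f : nat -> R -> R) : (forall k, expsum (f k)) ->
  expsum (fun l => \sum_(0 <= k < n) f k l).
Proof.
move=> ef; elim: n => [|n IH].
  by under eq_fun do rewrite big_geq//; exact: expsum_cst.
by under eq_fun do rewrite big_nat_recr//=; exact: expsum_add.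
Qed.

Lemma expsum_pow f n : expsum f -> expsum (fun l => f l ^+ n).
Proof.
move=> ef; elim: n => [|n IH].
  by under eq_fun do rewrite expr0; exact: expsum_cst.
by under eq_fun do rewrite exprS; exact: expsum_mul.
Qed.

Lemma measurable_expsum f : expsum f -> measurable_fun setT f.
Proof.
elim=> [a s _ _|g h _ mg _ mh]; last exact: measurable_funD.
by apply: measurable_funM => //; do 2 apply: measurableT_comp => //; exact: measurable_funM.
Qed.

Lemma expsum_bounds f l : expsum f -> 0 <= l -> 0 <= f l <= f 0.
Proof.
move=> + l0; elim=> [a s a0 s0|g h _ /andP[g0 g1] _ /andP[h0 h1]].
  rewrite mulr_ge0 ?expR_ge0//= ler_wpM2l// ler_expR lerN2 mulr0.
  exact: mulr_ge0.
by rewrite addr_ge0//= lerD.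
Qed.

Lemma measurable_eucl_sq N (m : R -> R) : measurable_fun setT m ->
  measurable_fun setT (fun y : eucl R N => m (eucl_dot y y)).
Proof. by move=> mm; apply: measurableT_comp mm _; exact: measurable_eucl_dot. Qed.

Lemma integrable_cosM0 N (x : eucl R N) (f : eucl R N -> R) :
  (leb N).-integrable setT (EFin \o f) ->
  (leb N).-integrable setT (fun y => (cos (eucl_dot x y) * f y)%:E).
Proof.
move=> /(integrable_cosM 0 x); apply: eq_integrable => // y _.
by rewrite add0r.
Qed.

Lemma radial_fourierD N (f g : R -> R) (x : eucl R N) :
  (leb N).-integrable setT (fun y => (f (eucl_dot y y))%:E) ->
  (leb N).-integrable setT (fun y => (g (eucl_dot y y))%:E) ->
  radial_fourier (fun l => f l + g l) x = radial_fourier f x + radial_fourier g x.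
Proof.
move=> fi gi; rewrite /radial_fourier -mulrDr -RintegralD//; last 2 first.
- exact: (integrable_cosM0 x fi).
- exact: (integrable_cosM0 x gi).
by congr (_ * _); apply: eq_Rintegral => y _; rewrite mulrDr.
Qed.

Lemma radial_fourierZ N (a : R) (f : R -> R) (x : eucl R N) :
  (leb N).-integrable setT (fun y => (f (eucl_dot y y))%:E) ->
  radial_fourier (fun l => a * f l) x = a * radial_fourier f x.
Proof.
move=> fi; rewrite /radial_fourier [RHS]mulrCA; congr (_ * _); rewrite -RintegralZl//; last exact: (integrable_cosM0 x fi).
by apply: eq_Rintegral => y _; rewrite mulrCA.
Qed.

Lemma kernel_boundsD N K M1 M2 (f g : eucl R N -> R) :
  kernel_bounds K M1 f -> kernel_bounds K M2 g -> kernel_bounds K (M1 + M2) (fun x => f x + g x).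
Proof.
move=> [mf f0 fK f1] [mg g0 gK g1]; split.
- exact: measurable_funD.
- by move=> x; rewrite addr_ge0.
- by move=> x; rewrite !mulrDr lerD.
- move=> x; under eq_integral do rewrite EFinD.
  rewrite ge0_integralD//; first by rewrite EFinD; exact: leeD.
  + by move=> y _; rewrite lee_fin.
  + by apply/measurable_EFinP; apply: measurableT_comp mf _; exact: measurable_eucl_sub.
  + by move=> y _; rewrite lee_fin.
  + by apply/measurable_EFinP; apply: measurableT_comp mg _; exact: measurable_eucl_sub.
Qed.

Lemma kernel_boundsZ N K M a (f : eucl R N -> R) : 0 <= a ->
  kernel_bounds K M f -> kernel_bounds K (a * M) (fun x => a * f x).
Proof.
move=> a0 [mf f0 fK f1]; split.
- exact: measurable_funM.
- by move=> x; rewrite mulr_ge0.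
- by move=> x; rewrite mulrCA [leRHS]mulrCA ler_wpM2l.
- move=> x; under eq_integral do rewrite EFinM.
  rewrite ge0_integralZl//; first by rewrite EFinM; exact: lee_wpmul2l.
  + by apply/measurable_EFinP; apply: measurableT_comp mf _; exact: measurable_eucl_sub.
  + by move=> y _; rewrite lee_fin.
Qed.

Lemma kernel_bounds_cvg N K M (k_ : nat -> eucl R N -> R) (k : eucl R N -> R) :
  (forall n, kernel_bounds K M (k_ n)) -> (forall x, k_ n x @[n --> \oo] --> k x) ->
  kernel_bounds K M k.
Proof.
move=> dk kk; have mk n : measurable_fun setT (k_ n) by case: (dk n).
have k0 n x : 0 <= k_ n x by case: (dk n).
split.
- by apply: (measurable_fun_cvg mk) => x _; exact: kk.
- by move=> x; rewrite -(cvg_lim _ (kk x))//; apply: limr_ge; [exact: cvgP (kk x)|exact: nearW].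
- move=> x; have kx : eucl_norm x ^+ N * k_ n x @[n --> \oo] --> eucl_norm x ^+ N * k x.
    by apply: cvgMl_tmp; exact: kk.
  rewrite -(cvg_lim _ kx)//; apply: limr_le; first exact: cvgP kx.
  by apply: nearW => n; case: (dk n).
- move=> x.
  have mkx n : measurable_fun setT (fun y => (k_ n (eucl_sub x y))%:E).
    by apply/measurable_EFinP; apply: measurableT_comp (mk n) _; exact: measurable_eucl_sub.
  have := @fatou _ _ _ (leb N) setT measurableT (fun n y => (k_ n (eucl_sub x y))%:E) mkx.
  under eq_integral => y _.
    rewrite (_ : limn_einf _ = (k (eucl_sub x y))%:E); first over.
    by apply: (cvg_limn_einf_sup _).1; apply: cvg_EFin; [exact: nearW|exact: kk].
  move=> h; apply: le_trans (h _) _; first by move=> n y _; rewrite lee_fin.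
  rewrite limn_einf_lim; apply: lime_le; first exact: is_cvg_einfs.
  apply: nearW => n; apply: (@le_trans _ _ (\int[leb N]_y (k_ n (eucl_sub x y))%:E)%E).
    by apply: ereal_inf_lbound; exists n => /=.
  by case: (dk n).
Qed.

Lemma radial_fourier_cvg N (m_ : nat -> R -> R) (m g : R -> R) (x : eucl R N) :
  (forall n, measurable_fun setT (m_ n)) -> measurable_fun setT m ->
  (forall l, 0 <= l -> m_ n l @[n --> \oo] --> m l) ->
  (forall n l, 0 <= l -> `|m_ n l| <= g l) ->
  (leb N).-integrable setT (fun y => (g (eucl_dot y y))%:E) ->
  radial_fourier (m_ n) x @[n --> \oo] --> radial_fourier m x.
Proof.
move=> mm_ mm mcv mg gi; rewrite /radial_fourier; apply: cvgMl_tmp.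
have mc (f : R -> R) : measurable_fun setT f ->
    measurable_fun setT (fun y => (cos (eucl_dot x y) * f (eucl_dot y y))%:E).
  move=> mf; apply/measurable_EFinP; apply: measurable_funM; last exact: measurable_eucl_sq.
  by apply: measurableT_comp; [exact: measurable_cos|exact: measurable_eucl_dot].
have [ ] := @dominated_convergence _ _ _ (leb N) setT measurableT
  (fun n y => (cos (eucl_dot x y) * m_ n (eucl_dot y y))%:E)
  (fun y => (cos (eucl_dot x y) * m (eucl_dot y y))%:E)
  (fun y => (g (eucl_dot y y))%:E) (fun n => mc _ (mm_ n)) (mc _ mm).
- apply: aeW => y _; apply: cvg_EFin; first exact: nearW.
  by apply: cvgMl_tmp; apply: mcv; exact: eucl_dot_ge0.
- exact: gi.
- apply: aeW => y n _; rewrite lee_fin normrM.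
  apply: le_trans (mg n _ (eucl_dot_ge0 y)); rewrite ler_piMl//; exact: norm_cos_le1.
move=> ci _ cv; rewrite -[X in _ --> X]fineK in cv; last exact: integrable_fin_num.
exact: (fine_cvg cv).
Qed.

(* The damping factor makes dominated convergence applicable to pointwise limits
   of such m, without any integrability assumption on m. *)
Definition damped_bounds N (m : R -> R) :=
  [/\ measurable_fun setT m, forall l, 0 <= l -> 0 <= m l <= 1 &
     forall e : R, 0 < e -> kernel_bounds (kernel_const N) 1 (@radial_fourier _ N (fun l => m l * expR (- (e * l))))].

Let measurable_damp (m : R -> R) e : measurable_fun setT m ->
  measurable_fun setT (fun l => m l * expR (- (e * l))).
Proof.
by move=> mm; apply: measurable_funM => //; do 2 apply: measurableT_comp => //; exact: measurable_funM.
Qed.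

Lemma norm_le1_01 (x : R) : 0 <= x <= 1 -> `|x| <= 1.
Proof. by move=> /andP[x0 x1]; rewrite ger0_norm. Qed.

Lemma damped_bounds_expsum N f : expsum f -> f 0 <= 1 -> damped_bounds N f.
Proof.
move=> ef f01; split; first exact: measurable_expsum.
  by move=> l l0; have /andP[-> /le_trans ->] := expsum_bounds ef l0.
(* The induction is run with the exact mass [f 0], which is additive, and this is weakened to 1 only
   at the end. Damping turns the rate s into s + e > 0, so that a constant term also becomes a
   genuine Gaussian. *)
move=> e e0; have : kernel_bounds (kernel_const N) (f 0) (@radial_fourier _ N (fun l => f l * expR (- (e * l)))).
  elim: ef {f01} => [a s a0 s0|g h eg IHg eh IHh].
    rewrite mulr0 oppr0 expR0.
    rewrite (_ : radial_fourier _ = fun x : eucl R N => a * radial_fourier (fun l => expR (- ((s + e) * l))) x).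
      by apply: kernel_boundsZ => //; apply: kernel_bounds_gauss; rewrite ltr_wpDl.
    apply/funext => x; rewrite -radial_fourierZ; last by apply: integrable_eucl_gauss; rewrite ltr_wpDl.
    apply: (congr1 (fun m => radial_fourier m x)); apply/funext => l.
    by rewrite -mulrA -expRD -opprD -mulrDl.
  have dint (u : R -> R) : expsum u ->
      (leb N).-integrable setT (fun y => (u (eucl_dot y y) * expR (- (e * eucl_dot y y)))%:E).
    move=> eu; have mu := measurable_expsum eu.
    have u0 : 0 <= u 0 by case/andP: (expsum_bounds eu (lexx 0)).
    have := integrableZl (measurableT) (u 0) (integrable_eucl_gauss N e0).
    apply: le_integrable => //.
      by apply/measurable_EFinP; apply: (@measurable_eucl_sq N (fun l => u l * expR (- (e * l)))); exact: measurable_damp.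
    move=> y _; rewrite -EFinM !abse_EFin lee_fin !normrM ler_wpM2r//.
    have /andP[h1 h2] := expsum_bounds eu (eucl_dot_ge0 y).
    by rewrite !ger0_norm.
  rewrite (_ : radial_fourier _ = fun x : eucl R N => radial_fourier (fun l => g l * expR (- (e * l))) x +
     radial_fourier (fun l => h l * expR (- (e * l))) x); first exact: kernel_boundsD.
  apply/funext => x; rewrite -radial_fourierD; [|exact: dint|exact: dint].
  by apply: (congr1 (fun m => radial_fourier m x)); apply/funext => l; rewrite mulrDl.
move=> [h1 h2 h3 h4].
have K0 : 0 <= kernel_const N :> R by rewrite /kernel_const divr_ge0 ?addr_ge0 ?exprn_ge0.
split => //.
  by move=> x; apply: le_trans (h3 x) _; rewrite ler_wpM2l.
by move=> x; apply: le_trans (h4 x) _; rewrite lee_fin.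
Qed.

Lemma damped_bounds_cvg N (m_ : nat -> R -> R) (m : R -> R) :
  (forall n, damped_bounds N (m_ n)) -> measurable_fun setT m ->
  (forall l, 0 <= l -> m_ n l @[n --> \oo] --> m l) -> damped_bounds N m.
Proof.
move=> gm mm mcv.
have mm_ n : measurable_fun setT (m_ n) by case: (gm n).
have m01 n l : 0 <= l -> 0 <= m_ n l <= 1 by case: (gm n) => _ + _; exact.
split => //.
  move=> l l0; have ml := mcv l l0; rewrite -(cvg_lim _ ml)//; apply/andP; split.
    by apply: limr_ge; [exact: cvgP ml|apply: nearW => n; case/andP: (m01 n l l0)].
  by apply: limr_le; [exact: cvgP ml|apply: nearW => n; case/andP: (m01 n l l0)].
move=> e e0; apply: (@kernel_bounds_cvg N _ _ (fun n => radial_fourier (fun l => m_ n l * expR (- (e * l))))).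
  by move=> n; case: (gm n) => _ _; exact.
move=> x; apply: (@radial_fourier_cvg N _ _ (fun l => expR (- (e * l)))).
- by move=> n; exact: measurable_damp.
- exact: measurable_damp.
- by move=> l l0; apply: cvgMr_tmp; exact: mcv.
- move=> n l l0; rewrite normrM (ger0_norm (expR_ge0 _)) ler_piMl ?expR_ge0//.
  exact/norm_le1_01/m01.
- exact: integrable_eucl_gauss.
Qed.

(** Removal of the damping: e = 1 / (n + 1) tends to 0, with m itself as dominating function. *)
Lemma kernel_bounds_damped_bounds N (m : R -> R) : damped_bounds N m ->
  (leb N).-integrable setT (fun y => (m (eucl_dot y y))%:E) ->
  kernel_bounds (kernel_const N) 1 (@radial_fourier _ N m).
Proof.
move=> [mm m01 gm] mi.
apply: (@kernel_bounds_cvg N _ _ (fun n => radial_fourier (fun l => m l * expR (- (n.+1%:R^-1 * l))))).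
  by move=> n; apply: gm; rewrite invr_gt0.
move=> x; apply: (@radial_fourier_cvg N _ _ m) => //.
- by move=> n; exact: measurable_damp.
- move=> l l0; rewrite -[X in _ --> X]mulr1; apply: cvgMl_tmp.
  rewrite -[X in _ --> X]expR0; apply: continuous_cvg; first exact: continuous_expR.
  rewrite -[X in _ --> X]oppr0; apply: cvgN; rewrite -[X in _ --> X](mul0r l).
  by apply: cvgMr_tmp; exact: cvg_harmonic.
- move=> n l l0; rewrite normrM (ger0_norm (expR_ge0 _)).
  have /andP[h1 h2] := m01 l l0; rewrite ger0_norm// ler_piMr//.
  by rewrite -expR0 ler_expR oppr_le0 mulr_ge0// invr_ge0.
Qed.
End kernels.

(** * Fractional powers as limits of Bernstein functions *)

Section bernstein.
Context {R : realType}.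
Variable N : nat.

(** The compound Poisson symbol: exp(- h 0) exp(h l) is the limit of exp(- h 0) times the Taylor
    polynomials in h l, which are exponential sums with value at most 1 at l = 0. *)
Lemma damped_bounds_exp_expsum (h : R -> R) : expsum h ->
  damped_bounds N (fun l => expR (- (h 0 - h l))).
Proof.
move=> eh; have mh := measurable_expsum eh.
pose p n l := expR (- h 0) * \sum_(0 <= k < n) (k`!%:R)^-1 * h l ^+ k.
have cvgexp (x : R) : \sum_(0 <= k < n) (k`!%:R)^-1 * x ^+ k @[n --> \oo] --> expR x.
  rewrite (_ : (fun _ => _) = series (exp_coeff x)); first exact: is_cvg_series_exp_coeff.
  by apply/funext => n; apply: eq_bigr => k _; rewrite mulrC.
apply: (@damped_bounds_cvg _ N p).
- move=> n; apply: damped_bounds_expsum.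
    apply: expsum_scale; first exact: expR_ge0.
    apply: expsum_sum => k; apply: expsum_scale; last exact: expsum_pow.
    by rewrite invr_ge0.
  have h0 : 0 <= h 0 by case/andP: (expsum_bounds eh (lexx 0)).
  rewrite /p expRN ler_pdivrMl ?expR_gt0// mulr1.
  rewrite -(cvg_lim _ (cvgexp (h 0)))//.
  apply: (nondecreasing_cvgn_le (u_ := fun n => \sum_(0 <= k < n) (k`!%:R)^-1 * h 0 ^+ k)); last exact: cvgP (cvgexp (h 0)).
  apply/nondecreasing_seqP => j.
  by rewrite big_nat_recr//= lerDl mulr_ge0 ?invr_ge0 ?exprn_ge0.
- apply: measurableT_comp => //; apply: measurableT_comp => //.
  exact: measurable_funB.
- move=> l l0; rewrite opprB addrC expRD; apply: cvgMl_tmp; exact: cvgexp.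
Qed.

Section geometric_sum.
Variables (q A : R).
Hypotheses (q1 : 1 < q) (A0 : 0 < A) (A1 : A < 1) (Aq : 1 < A * q).

Let q0 : 0 < q. Proof. exact: lt_trans q1. Qed.

(* With [A = q^-alpha], [psi l] below is the sum over k in Z of
   [(1 - exp(- q^k l)) q^(- alpha k)], a discretization of the integral of
   [(1 - exp(- s l)) s^(- alpha - 1)] over s > 0.  Unlike a Riemann sum it is exactly
   homogeneous along powers of q ([psiM]), so no integral has to be computed. *)
Definition tpos k (l : R) := (1 - expR (- (q ^+ k * l))) * A ^+ k.
Definition tneg k (l : R) := (1 - expR (- (q ^- k.+1 * l))) * A ^- k.+1.
Definition psi_sum n l := \sum_(0 <= k < n) (tpos k l + tneg k l).

Let tau_bounds (z : R) : 0 <= z -> 0 <= 1 - expR (- z) <= 1 /\ 1 - expR (- z) <= z.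
Proof.
move=> z0; have := expR_ge0 (- z); have := expR_ge1Dx (- z).
have : expR (- z) <= 1 by rewrite -expR0 ler_expR oppr_le0.
by split; lra.
Qed.

Let tpos_bounds k l : 0 <= l -> 0 <= tpos k l <= A ^+ k.
Proof.
move=> l0; have [/andP[h1 h2] _] := tau_bounds (mulr_ge0 (exprn_ge0 k (ltW q0)) l0).
by rewrite mulr_ge0 ?exprn_ge0 ?(ltW A0)//= ler_piMl ?exprn_ge0 ?(ltW A0).
Qed.

Let tneg_bounds k l : 0 <= l -> 0 <= tneg k l <= l * ((A * q)^-1) ^+ k.+1.
Proof.
move=> l0; have qk : 0 <= q ^- k.+1 by rewrite invr_ge0 exprn_ge0// ltW.
have [/andP[h1 _] h2] := tau_bounds (mulr_ge0 qk l0).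
have Ak : 0 <= A ^- k.+1 by rewrite invr_ge0 exprn_ge0// ltW.
rewrite mulr_ge0//=; apply: le_trans (ler_wpM2r Ak h2) _.
by rewrite exprVn exprMn invfM [_ * l]mulrC mulrAC mulrA.
Qed.

Let Aq01 : 0 <= (A * q)^-1 < 1.
Proof. by rewrite invr_ge0 mulr_ge0 ?ltW//= invf_lt1// (lt_trans ltr01). Qed.

Lemma cvg_tpos l : 0 <= l -> tpos k l @[k --> \oo] --> (0 : R).
Proof.
move=> l0; apply: (@squeeze_cvgr _ _ _ _ (fun=> 0) (fun k => A ^+ k)).
- by apply: nearW => k; exact: tpos_bounds.
- exact: cvg_cst.
- by apply: cvg_expr; rewrite ger0_norm ?ltW.
Qed.

Lemma cvg_tneg l : 0 <= l -> tneg k l @[k --> \oo] --> (0 : R).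
Proof.
move=> l0; apply: (@squeeze_cvgr _ _ _ _ (fun=> 0) (fun k => l * (A * q)^-1 ^+ k.+1)).
- by apply: nearW => k; exact: tneg_bounds.
- exact: cvg_cst.
- rewrite -[X in _ --> X](mulr0 l); apply: cvgMl_tmp.
  rewrite (cvg_shiftS (fun k => (A * q)^-1 ^+ k)).
  by case/andP: Aq01 => h1 h2; apply: cvg_expr; rewrite ger0_norm.
Qed.

(** A < 1 sums the terms with q^k, where 1 - exp(- z) <= 1 is used; A q > 1 sums those with
    q^-(k+1), where 1 - exp(- z) <= z is used. For A = q^-alpha these two conditions are 0 < alpha
    and alpha < 1. *)
Lemma is_cvg_psi_sum l : 0 <= l -> cvgn (psi_sum ^~ l).
Proof.
move=> l0; apply: (@series_le_cvg _ _ (fun k => A ^+ k + l * (A * q)^-1 * (A * q)^-1 ^+ k)).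
- move=> k; rewrite addr_ge0//; first by case/andP: (tpos_bounds k l0).
  by case/andP: (tneg_bounds k l0).
- move=> k; case/andP: Aq01 => h1 h2; rewrite addr_ge0 ?mulr_ge0 ?exprn_ge0// ltW//.
- move=> k; rewrite -mulrA -exprS.
  by apply: lerD; [case/andP: (tpos_bounds k l0)|case/andP: (tneg_bounds k l0)].
- apply: is_cvg_seriesD.
    have := @is_cvg_geometric_series R 1 A; rewrite /geometric.
    by under eq_fun do rewrite mul1r; apply; rewrite ger0_norm ?ltW.
  apply: is_cvg_geometric_series.
  by case/andP: Aq01 => h1 h2; rewrite ger0_norm.
Qed.

Definition psi l := limn (psi_sum ^~ l).

Lemma cvg_psi l : 0 <= l -> psi_sum n l @[n --> \oo] --> psi l.
Proof. exact: is_cvg_psi_sum. Qed.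

(** Multiplying l by q shifts the index k in Z by one. On the truncated sum this leaves one boundary
    term at each end, and both vanish in the limit. *)
Lemma psi_sumM n l : psi_sum n.+1 (q * l) = A^-1 * (psi_sum n.+1 l + tpos n.+1 l - tneg n l).
Proof.
have tp k : tpos k (q * l) = A^-1 * tpos k.+1 l.
  rewrite /tpos mulrA -exprSr [A ^+ k.+1]exprS mulrCA mulKf ?gt_eqF//.
have tn k : tneg k.+1 (q * l) = A^-1 * tneg k l.
  rewrite /tneg mulrA [q ^+ k.+2]exprSr invfM -[_ * q^-1 * q]mulrA mulVf ?gt_eqF// mulr1.
  by rewrite [A ^+ k.+2]exprS invfM mulrCA.
have t0 : tneg 0 (q * l) = A^-1 * tpos 0 l.
  by rewrite /tneg /tpos !expr1 !expr0 mulrA mulVf ?gt_eqF// mulr1 mulrC.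
elim: n => [|n IH].
  by rewrite /psi_sum !big_nat1 tp t0; ring.
rewrite /psi_sum big_nat_recr//= -/(psi_sum n.+1 (q * l)) IH tp tn.
rewrite [in RHS]big_nat_recr//= -/(psi_sum n.+1 l); ring.
Qed.

Lemma psiM l : 0 <= l -> psi (q * l) = A^-1 * psi l.
Proof.
move=> l0; have ql : 0 <= q * l by rewrite mulr_ge0// ltW.
have c1 : psi_sum n.+1 (q * l) @[n --> \oo] --> psi (q * l).
  by rewrite (cvg_shiftS (psi_sum ^~ (q * l))); exact: cvg_psi.
have c2 : psi_sum n.+1 (q * l) @[n --> \oo] --> A^-1 * (psi l + 0 - 0).
  rewrite (_ : (fun n => _) = fun n => A^-1 * (psi_sum n.+1 l + tpos n.+1 l - tneg n l)); last first.
    by apply/funext => n; rewrite psi_sumM.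
  apply: cvgMl_tmp; apply: cvgB; last exact: cvg_tneg.
  apply: cvgD; first by rewrite (cvg_shiftS (psi_sum ^~ l)); exact: cvg_psi.
  by rewrite (cvg_shiftS (tpos ^~ l)); exact: cvg_tpos.
by rewrite subr0 addr0 in c2; exact: (cvg_unique _ c1 c2).
Qed.

Lemma psi_le l1 l2 : 0 <= l1 -> l1 <= l2 -> psi l1 <= psi l2.
Proof.
move=> l10 l12; have l20 := le_trans l10 l12.
apply: ler_lim; [exact: cvg_psi|exact: cvg_psi|apply: nearW => n].
apply: ler_sum => k _; apply: lerD; apply: ler_wpM2r.
- by rewrite exprn_ge0 ?ltW.
- by rewrite lerB// ler_expR lerN2 ler_wpM2l// exprn_ge0 ?ltW.
- by rewrite invr_ge0 exprn_ge0 ?ltW.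
- by rewrite lerB// ler_expR lerN2 ler_wpM2l// invr_ge0 exprn_ge0 ?ltW.
Qed.

Lemma psi_gt0 : 0 < psi 1.
Proof.
have h : 0 < tpos 0 1.
  by rewrite /tpos !expr0 !mulr1 subr_gt0 expR_lt1 oppr_lt0.
apply: lt_le_trans h _; have c := cvg_psi ler01.
apply: (@le_trans _ _ (psi_sum 1 1)).
  by rewrite /psi_sum big_nat1 lerDl; case/andP: (tneg_bounds 0 ler01).
apply: (nondecreasing_cvgn_le (u_ := psi_sum ^~ 1)); last exact: is_cvg_psi_sum.
apply/nondecreasing_seqP => j; rewrite /psi_sum big_nat_recr//= lerDl addr_ge0//.
  by case/andP: (tpos_bounds j ler01).
by case/andP: (tneg_bounds j ler01).
Qed.

Lemma psi0 : psi 0 = 0.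
Proof.
rewrite /psi (_ : psi_sum ^~ 0 = fun=> 0) ?lim_cst//.
apply/funext => n; rewrite /psi_sum big1// => k _.
by rewrite /tpos /tneg !mulr0 oppr0 expR0 subrr !mul0r addr0.
Qed.

(** The series of [psi] is controlled for l >= 0 only; [Num.max l 0] yields a symbol measurable on
    the whole line without changing the values met at l = |xi|^2. *)
Lemma damped_bounds_psi (c : R) : 0 <= c -> damped_bounds N (fun l => expR (- (c * psi (Num.max l 0)))).
Proof.
move=> c0; apply: (@damped_bounds_cvg _ N (fun n l => expR (- (c * psi_sum n l)))).
(* Chosen so that h 0 - h l = c [psi_sum n l]. *)
- move=> n; pose h (l : R) := \sum_(0 <= k < n)
    (c * A ^+ k * expR (- (q ^+ k * l)) + c * A ^- k.+1 * expR (- (q ^- k.+1 * l))).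
  have eh : expsum h.
    apply: expsum_sum => k; apply: expsum_add; apply: expsum_exp.
    + by rewrite mulr_ge0// exprn_ge0// ltW.
    + by rewrite exprn_ge0// ltW.
    + by rewrite mulr_ge0// invr_ge0 exprn_ge0// ltW.
    + by rewrite invr_ge0 exprn_ge0// ltW.
  have := damped_bounds_exp_expsum eh; rewrite (_ : (fun _ => _) = fun l => expR (- (c * psi_sum n l)))//.
  apply/funext => l; congr (expR (- _)); rewrite /h /psi_sum -sumrB mulr_sumr.
  apply: eq_bigr => k _; rewrite !mulr0 oppr0 expR0 /tpos /tneg.
  move: (A ^- _) (expR (- (q ^- _ * _))) => ? ?; ring.
- do 2 apply: measurableT_comp => //; apply: measurable_funM => //.
  apply: (@measurable_fun_cvg _ (measurableTypeR R) R setT (fun n l => psi_sum n (Num.max l 0))).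
    move=> n; apply: measurable_sum => k; rewrite /tpos /tneg.
    have mm (a b : R) : measurable_fun setT (fun l : R => (1 - expR (- (a * Num.max l 0))) * b).
      apply: measurable_funM => //; apply: measurable_funB => //.
      do 2 apply: measurableT_comp => //; apply: measurable_funM => //.
      exact: measurable_maxr.
    apply: measurable_funD; exact: mm.
  by move=> l _; apply: cvg_psi; rewrite le_max lexx orbT.
- move=> l l0; rewrite (max_idPl l0); apply: continuous_cvg; first exact: continuous_expR.
  by apply: cvgN; apply: cvgMl_tmp; exact: cvg_psi.
Qed.
End geometric_sum.

End bernstein.

Section bernstein2.
Context {R : realType}.
(** Round ln l / ln q down and up to integers: f is known exactly at the integer powers of q, and
    monotonicity loses at most a factor q^alpha on either side. *)
Lemma homogeneous_bounds (q alpha : R) (f : R -> R) : 1 < q -> 0 <= alpha ->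
  (forall l1 l2, 0 <= l1 -> l1 <= l2 -> f l1 <= f l2) -> f 1 = 1 ->
  (forall l, 0 <= l -> f (q * l) = q `^ alpha * f l) ->
  forall l, 0 < l -> q `^ (- alpha) * l `^ alpha <= f l <= q `^ alpha * l `^ alpha.
Proof.
move=> q1 a0 f_mono f1 fq l l0.
have q0 : 0 < q by exact: lt_trans q1.
have fpow (n : nat) : f (q ^+ n) = (q `^ alpha) ^+ n.
  by elim: n => [//|n IH]; rewrite exprS fq ?exprn_ge0 ?IH ?exprS// ltW.
have fpowM (n : nat) z : 0 <= z -> f (q ^+ n * z) = (q `^ alpha) ^+ n * f z.
  move=> z0; elim: n => [|n IH]; first by rewrite !expr0 !mul1r.
  by rewrite exprS -mulrA fq ?IH ?exprS ?mulrA// mulr_ge0// exprn_ge0// ltW.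
have fint (j : int) : f (q `^ j%:~R) = q `^ (alpha * j%:~R).
  case: j => n.
    by rewrite -pmulrn powR_mulrn ?(ltW q0)// fpow powRrM powR_mulrn// powR_ge0.
  have Aq : 0 < (q `^ alpha) ^+ n.+1 by rewrite exprn_gt0// powR_gt0.
  rewrite NegzE mulrNz mulrN !powRN -pmulrn powR_mulrn ?(ltW q0)// powRrM powR_mulrn ?powR_ge0//.
  apply: (mulfI (lt0r_neq0 Aq)); rewrite -fpowM ?invr_ge0 ?exprn_ge0 ?(ltW q0)//.
  by rewrite !mulfV ?f1// lt0r_neq0// exprn_gt0.
have lnq : 0 < ln q by rewrite ln_gt0.
pose x := ln l / ln q.
have lx : l = q `^ x by rewrite /powR gt_eqF// divfK ?gt_eqF// lnK.
have /andP[j1 j2] := floor_itv x.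
have lea u v : u <= v -> q `^ u <= q `^ v by apply: ler_powR; exact: ltW.
have la y : q `^ (alpha * (x + y)) = q `^ (alpha * y) * l `^ alpha.
  by rewrite lx -powRrM -gt0_powRD//; congr (_ `^ _); ring.
apply/andP; split.
  apply: (@le_trans _ _ (f (q `^ (Num.floor x)%:~R))); last first.
    by apply: f_mono; [exact: powR_ge0|rewrite lx; exact: lea].
  rewrite fint -[- alpha]mulrN1 -la; apply: lea; rewrite ler_wpM2l//.
  by move: j2; rewrite intrD1; lra.
apply: (@le_trans _ _ (f (q `^ (Num.floor x + 1)%:~R))).
  by apply: f_mono; [exact: ltW|rewrite lx; apply/lea/ltW].
rewrite fint -[X in _ <= q `^ X * _]mulr1 -la; apply: lea; rewrite ler_wpM2l//.
by rewrite intrD1 lerD2r.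
Qed.

(** As q tends to 1 the two factors in [homogeneous_bounds] tend to 1, so [psi] divided by its value
    at 1 tends to l^alpha. This normalization stands in for the Levy-Khintchine constant. *)
Lemma damped_bounds_exp_powR N (t alpha : R) : 0 <= t -> 0 < alpha < 1 ->
  damped_bounds N (fun l => expR (- (t * l `^ alpha))).
Proof.
move=> t0 /andP[a0 a1].
pose q n : R := expR n.+1%:R^-1; pose A n := q n `^ (- alpha).
have q1 n : 1 < q n by rewrite expR_gt1 invr_gt0.
have q0 n : 0 < q n by exact: expR_gt0.
have A0 n : 0 < A n by rewrite powR_gt0.
have qpow n (b : R) : q n `^ b = expR (b * n.+1%:R^-1) by rewrite /powR gt_eqF// expRK.
have A1 n : A n < 1 by rewrite /A qpow expR_lt1 mulNr oppr_lt0 mulr_gt0// invr_gt0.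
have Aq n : 1 < A n * q n.
  rewrite /A -{2}(powRr1 (ltW (q0 n))) -gt0_powRD// qpow expR_gt1 mulr_gt0// ?invr_gt0//.
  by rewrite addrC subr_gt0.
have qcv (b : R) : q n `^ b @[n --> \oo] --> (1 : R).
  rewrite (_ : (fun n => _) = fun n => expR (b * n.+1%:R^-1)); last first.
    by apply/funext => n; rewrite qpow.
  rewrite -[X in _ --> X]expR0; apply: continuous_cvg; first exact: continuous_expR.
  by rewrite -[X in _ --> X](mulr0 b); apply: cvgMl_tmp; exact: cvg_harmonic.
pose f n l := psi (q n) (A n) l / psi (q n) (A n) 1.
have p0 n := psi_gt0 (q1 n) (A0 n) (A1 n) (Aq n).
have fb n l : 0 < l -> q n `^ (- alpha) * l `^ alpha <= f n l <= q n `^ alpha * l `^ alpha.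
  apply: homogeneous_bounds => //; first exact: ltW.
  - by move=> l1 l2 h1 h2; rewrite ler_wpM2r ?invr_ge0 ?(ltW (p0 n))// psi_le.
  - by rewrite /f mulfV// gt_eqF.
  - by move=> u u0; rewrite /f psiM// /A powRN invrK mulrA.
apply: (@damped_bounds_cvg _ N (fun n l => expR (- (t / psi (q n) (A n) 1 * psi (q n) (A n) (Num.max l 0))))).
- by move=> n; apply: damped_bounds_psi => //; rewrite divr_ge0// ltW.
- do 2 apply: measurableT_comp => //; apply: measurable_funM => //.
- move=> l l0; rewrite (max_idPl l0); apply: continuous_cvg; first exact: continuous_expR.
  apply: cvgN; rewrite (_ : (fun n => _) = fun n => t * f n l); last first.
    by apply/funext => n; rewrite /f; ring.
  apply: cvgMl_tmp; move: l0; rewrite le_eqVlt => /predU1P[<-|l0].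
    rewrite powR0 ?gt_eqF// (_ : (fun _ => _) = fun=> 0); first exact: cvg_cst.
    by apply/funext => n; rewrite /f psi0 mul0r.
  apply: (@squeeze_cvgr _ _ _ _ (fun n => q n `^ (- alpha) * l `^ alpha) (fun n => q n `^ alpha * l `^ alpha)).
  + by apply: nearW => n; exact: fb.
  + by rewrite -[X in _ --> X]mul1r; apply: cvgMr_tmp; exact: qcv.
  + by rewrite -[X in _ --> X]mul1r; apply: cvgMr_tmp; exact: qcv.
Qed.

End bernstein2.

(** * The fractional heat kernel *)

Section heat.
Context {R : realType}.
Local Notation leb N := (@lebesgue_eucl R N).

Let hsym (theta t l : R) := expR (- (t * l `^ (theta / 2))).

Lemma heat_kernelE N (theta : R) (x : eucl R N) (t : R) :
  heat_kernel theta x t = radial_fourier (hsym theta t) x.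
Proof.
rewrite /heat_kernel /heat_kernelC /complex_integral /radial_fourier /= (mul0r (Rintegral _ _ _)) subr0.
congr (_ * _); apply: eq_Rintegral => y _.
rewrite !mul0r !mul1r !subr0 !sub0r add0r mulrC /hsym -sqr_eucl_norm.
have -> // : eucl_norm y `^ theta = (eucl_norm y ^+ 2) `^ (theta / 2).
by rewrite -powR_mulrn ?eucl_norm_ge0// -powRrM mulrCA mulfV ?mulr1// pnatr_eq0.
Qed.

Let measurable_hsym theta t : measurable_fun setT (hsym theta t).
Proof.
do 2 apply: measurableT_comp => //; apply: measurable_funM => //.
Qed.

Lemma integral_hsym_le N (theta : R) : 0 < theta ->
  exists2 C, 0 <= C & forall t : R, 0 < t ->
  (\int[leb N]_x (hsym theta t (eucl_dot x x))%:E <= (C * t `^ (- (N%:R / theta)))%:E)%E.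
Proof.
move=> th0; have A0 : 0 <= 2 ^+ N :> R by rewrite exprn_ge0.
have [C C0 hC] := @integral_exp_npow_le R _ _ (leb N) _ _ N (@measurable_eucl_norm R N) A0
  (@lebesgue_eucl_ball_le R N) theta th0.
exists C; first exact: C0.
move=> t t0.
have E (x : eucl R N) : hsym theta t (eucl_dot x x) = expR (- (t * eucl_norm x `^ theta)) :> R.
  rewrite /hsym -(@sqr_eucl_norm R N) -powR_mulrn ?eucl_norm_ge0// -powRrM.
  by rewrite mulrCA mulfV ?mulr1// pnatr_eq0.
by under eq_integral do rewrite E; exact: hC.
Qed.

Lemma integrable_hsym N (theta t : R) : 0 < theta -> 0 < t ->
  (leb N).-integrable setT (fun y => (hsym theta t (eucl_dot y y))%:E).
Proof.
move=> th0 t0; have [C C0 hC] := integral_hsym_le N th0.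
apply/integrableP; split.
  by apply/measurable_EFinP; exact: measurable_eucl_sq.
under eq_integral do rewrite gee0_abs ?lee_fin ?expR_ge0//.
by apply: le_lt_trans (hC t t0) _; rewrite ltry.
Qed.

Lemma kernel_bounds_heat_kernel N (theta t : R) : 0 < theta <= 2 -> 0 < t ->
  kernel_bounds (kernel_const N) 1 (fun x : eucl R N => heat_kernel theta x t).
Proof.
move=> /andP[th0 th2] t0; under eq_fun do rewrite heat_kernelE.
have [th|th] := ltP theta 2.
  apply: kernel_bounds_damped_bounds; last exact: integrable_hsym.
  by apply: damped_bounds_exp_powR; [exact: ltW|rewrite divr_gt0//= ltr_pdivrMr// mul1r].
(* Here alpha = 1, where A q = 1 and the terms [tneg] no longer tend to 0; but the kernel is itself
   a Gaussian. *)
have -> : theta = 2 by apply/eqP; rewrite eq_le th2 th.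
rewrite (_ : (fun _ => _) = @radial_fourier _ N (fun l => expR (- (t * l)))); first exact: kernel_bounds_gauss.
apply/funext => x; rewrite /radial_fourier; congr (_ * _); apply: eq_Rintegral => y _.
by rewrite /hsym divff ?pnatr_eq0// powRr1// eucl_dot_ge0.
Qed.

Lemma heat_kernel_le N (theta : R) : 0 < theta ->
  exists2 C, 0 <= C & forall (x : eucl R N) (t : R), 0 < t ->
  heat_kernel theta x t <= C * t `^ (- (N%:R / theta)).
Proof.
move=> th0; have [C C0 hC] := integral_hsym_le N th0.
have p0 : 0 <= (2 * pi) ^- N :> R by rewrite invr_ge0 exprn_ge0// mulr_ge0 ?pi_ge0.
exists ((2 * pi) ^- N * C); first exact: mulr_ge0.
move=> x t t0; rewrite heat_kernelE /radial_fourier -mulrA ler_wpM2l//.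
have hi := integrable_hsym N th0 t0; have chi := integrable_cosM0 x hi.
rewrite -lee_fin; apply: le_trans (hC t t0).
rewrite fineK; last exact: integrable_fin_num.
apply: le_integral => // y _; rewrite lee_fin ler_piMl ?expR_ge0//.
Qed.

Lemma measurable_heat_kernel N (theta : R) :
  measurable_fun setT (fun z : eucl R N * measurableTypeR R => heat_kernel theta z.1 z.2).
Proof.
under eq_fun do rewrite heat_kernelE /radial_fourier.
apply: measurable_funM => //.
pose F (w : (eucl R N * measurableTypeR R) * eucl R N) : \bar R :=
  (cos (eucl_dot w.1.1 w.2) * hsym theta w.1.2 (eucl_dot w.2 w.2))%:E.
have mF : measurable_fun setT F.
  apply/measurable_EFinP; apply: measurable_funM.
    apply: measurableT_comp; first exact: measurable_cos.
    apply: measurable_eucl_dot; last exact: measurable_snd.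
    by apply: measurableT_comp; [exact: measurable_fst|exact: measurable_fst].
  do 2 apply: measurableT_comp => //; apply: measurable_funM.
    by apply: measurableT_comp; [exact: measurable_snd|exact: measurable_fst].
  apply: (@measurableT_comp _ _ _ _ _ _ (fun l : R => l `^ (theta / 2))) => //.
  by apply: measurable_eucl_dot; exact: measurable_snd.
have mG : measurable_fun setT (fun z => (\int[leb N]_y F (z, y))%E).
  (* The integrand changes sign and may fail to be integrable for t <= 0. Tonelli applied to its
     positive and negative parts gives measurability, their difference being the integral by
     definition. *)
  have mFp : measurable_fun setT (F ^\+)%E by exact: measurable_funepos.
  have mFn : measurable_fun setT (F ^\-)%E by exact: measurable_funeneg.
  have h1 := measurable_fun_fubini_tonelli_F (m2 := leb N) _ mFp (funepos_ge0 F).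
  have h2 := measurable_fun_fubini_tonelli_F (m2 := leb N) _ mFn (funeneg_ge0 F).
  rewrite [X in measurable_fun _ X](_ : _ = (fubini_F (leb N) F^\+ \- fubini_F (leb N) F^\-)%E).
    exact: emeasurable_funB.
  apply/funext => z; rewrite [LHS]integralE /fubini_F.
  by congr (_ - _)%E; apply: eq_integral => y _; rewrite ?funeposE ?funenegE.
by apply: measurableT_comp mG; exact: fine_measurable.
Qed.

End heat.

(** * Estimates for the integral equation *)

Section semigroup.
Context {R : realType}.
Local Notation leb N := (@lebesgue_eucl R N).

(* Extending the kernel by 0 to t <= 0 makes it nonnegative and measurable on the
   whole of space-time. *)
Definition causal_kernel N (theta : R) (x : eucl R N) (t : R) : \bar R :=
  if 0 < t then (heat_kernel theta x t)%:E else 0%E.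

Lemma measurable_causal_kernel N theta : measurable_fun setT
  (fun z : eucl R N * measurableTypeR R => causal_kernel theta z.1 z.2).
Proof.
apply: measurable_fun_ifT => //.
  by apply: measurable_fun_ltr => //; exact: measurable_snd.
by apply/measurable_EFinP; exact: measurable_heat_kernel.
Qed.

Lemma causal_kernel_ge0 N theta (x : eucl R N) t : 0 < theta <= 2 -> (0 <= causal_kernel theta x t)%E.
Proof.
move=> th; rewrite /causal_kernel; case: ifP => // t0; rewrite lee_fin.
by have [_ + _ _] := kernel_bounds_heat_kernel N th t0; exact.
Qed.

Lemma measurable_causal_kernel_comp N theta d (T : measurableType d) (f : T -> eucl R N) (g : T -> measurableTypeR R) :
  measurable_fun setT f -> measurable_fun setT g ->
  measurable_fun setT (fun z => causal_kernel theta (f z) (g z)).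
Proof.
move=> mf mg.
exact: (measurableT_comp (@measurable_causal_kernel N theta) (measurable_fun_pair mf mg)).
Qed.

Lemma measurable_causal_kernel_sub N theta (x : eucl R N) t :
  measurable_fun setT (fun y => causal_kernel theta (eucl_sub x y) t).
Proof.
by apply: measurable_causal_kernel_comp => //; exact: measurable_eucl_sub.
Qed.

Lemma integral_causal_kernel_le1 N theta (x : eucl R N) t : 0 < theta <= 2 ->
  (\int[leb N]_y causal_kernel theta (eucl_sub x y) t <= 1)%E.
Proof.
move=> th; rewrite /causal_kernel; case: (boolP (0 < t)) => t0; last by rewrite integral0.
by have [_ _ _ +] := kernel_bounds_heat_kernel N th t0; exact.
Qed.

Lemma measurable_npow_norm N b : measurable_fun setT (fun y : eucl R N => npow b (eucl_norm y)).
Proof. by apply: measurableT_comp; [exact: measurable_npow|exact: measurable_eucl_norm]. Qed.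

(** From |x|^2 <= 2 |x - y|^2 + 2 |y|^2, which holds coordinate by coordinate and stands in for the
    triangle inequality. *)
Lemma half_norm_le N (x y : eucl R N) : eucl_norm y < eucl_norm x / 2 ->
  eucl_norm x / 2 <= eucl_norm (eucl_sub x y).
Proof.
move=> yx; have x0 := eucl_norm_ge0 x; have y0 := eucl_norm_ge0 y.
rewrite -(ler_pXn2r (n := 2)) ?nnegrE ?eucl_norm_ge0 ?divr_ge0//.
have h : eucl_dot x x <= 2 * eucl_dot (eucl_sub x y) (eucl_sub x y) + 2 * eucl_dot y y.
  rewrite /eucl_dot 2!mulr_sumr -[leRHS]big_split /=; apply: ler_sum => i _.
  rewrite !tnth_mktuple; move: (tnth x i) (tnth y i) => a b.
  by rewrite -subr_ge0 (_ : _ - _ = (a - 2 * b) ^+ 2) ?sqr_ge0//; ring.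
move: h; rewrite -!sqr_eucl_norm.
have : eucl_norm y ^+ 2 <= (eucl_norm x / 2) ^+ 2.
  by rewrite ler_pXn2r ?nnegrE ?divr_ge0// ltW.
by rewrite expr_div_n; lra.
Qed.

Lemma integral_causal_kernel_npow_core N (theta b : R) : 0 < theta <= 2 -> 0 < b < N%:R ->
  exists2 C : R, 0 <= C & forall (A rho t : R) (x : eucl R N), 0 <= A -> 0 < rho ->
  (forall y, eucl_norm y < rho -> (causal_kernel theta (eucl_sub x y) t <= (A * rho ^- N)%:E)%E) ->
  (\int[leb N]_y (causal_kernel theta (eucl_sub x y) t * npow b (eucl_norm y))
   <= ((A * C + 1) * rho `^ (- b))%:E)%E.
Proof.
move=> th /andP[b0 bN].
pose C : R := 2 ^+ N * 2 `^ b / (1 - 2 `^ (b - N%:R)).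
have two1 : 2 `^ (b - N%:R) < 1 :> R.
  rewrite -opprB powRN invf_lt1 ?powR_gt0//.
  have nb : 0 < N%:R - b by rewrite subr_gt0.
  by have := @gt0_ltr_powR R _ nb 1 2; rewrite powR1; apply; rewrite ?nnegrE ?ltr1n.
exists C; first by rewrite mulr_ge0 ?mulr_ge0 ?powR_ge0 ?exprn_ge0// invr_ge0 subr_ge0 ltW.
move=> A rho t x A0 rho0 hA.
have b0N : 0 <= b < N%:R by rewrite (ltW b0).
have N20 : 0 <= 2 ^+ N :> R by rewrite exprn_ge0.
have ball := @integral_ball_npow_le R _ _ (leb N) _ _ N (@measurable_eucl_norm R N)
  (@eucl_norm_ge0 R N) N20 (@lebesgue_eucl_ball_le R N) b rho b0N rho0.
have r0 : 0 <= A * rho ^- N by rewrite mulr_ge0// invr_ge0 exprn_ge0// ltW.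
have mhk := @measurable_causal_kernel_sub N theta x t.
have mnp := @measurable_npow_norm N b.
pose B := [set y : eucl R N | eucl_norm y < rho].
have mB : measurable B.
  rewrite /B -[X in measurable X]setTI; apply: measurable_fun_ltr => //.
  exact: measurable_eucl_norm.
have mI : measurable_fun setT (fun y => (\1_B y)%:E * npow b (eucl_norm y))%E.
  by apply: emeasurable_funM => //; apply/measurable_EFinP; exact: measurable_indic.
have I0 y : (0 <= (\1_B y)%:E * npow b (eucl_norm y))%E.
  by rewrite mule_ge0 ?npow_ge0// lee_fin.
apply: (@le_trans _ _ (\int[leb N]_y ((A * rho ^- N)%:E * ((\1_B y)%:E * npow b (eucl_norm y)) +
   (rho `^ (- b))%:E * causal_kernel theta (eucl_sub x y) t))%E).
  apply: ge0_le_integral => //.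
  - by move=> y _; rewrite mule_ge0 ?npow_ge0 ?causal_kernel_ge0.
  - exact: emeasurable_funM.
  - by apply: emeasurable_funD; apply: emeasurable_funM.
  - move=> y _; have [yr|yr] := ltP (eucl_norm y) rho.
      rewrite indicE mem_set// mul1e.
      apply: (@le_trans _ _ ((A * rho ^- N)%:E * npow b (eucl_norm y))%E).
        by rewrite lee_wpmul2r ?npow_ge0// hA.
      by rewrite leeDl// mule_ge0 ?causal_kernel_ge0// lee_fin powR_ge0.
    rewrite indicE memNset ?mul0e ?mule0 ?add0e; last by rewrite /B /= ltNge yr.
    rewrite muleC lee_wpmul2r ?causal_kernel_ge0// /npow gt_eqF ?(lt_le_trans rho0)// lee_fin.
    by apply: ler_npowR => //; exact: ltW.
rewrite ge0_integralD//; last 4 first.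
- by move=> y _; rewrite mule_ge0// lee_fin.
- exact: emeasurable_funM.
- by move=> y _; rewrite mule_ge0 ?causal_kernel_ge0// lee_fin powR_ge0.
- exact: emeasurable_funM.
rewrite (ge0_integralZl (leb N) measurableT mI (fun y _ => I0 y)) ?lee_fin//.
rewrite (ge0_integralZl (leb N) measurableT mhk (fun y _ => causal_kernel_ge0 _ _ th)) ?lee_fin ?powR_ge0//.
apply: (@le_trans _ _ ((A * rho ^- N)%:E * (C * rho `^ (N%:R - b))%:E + (rho `^ (- b))%:E * 1)%E).
  apply: leeD; apply: lee_wpmul2l; rewrite ?lee_fin ?powR_ge0//.
  exact: integral_causal_kernel_le1.
rewrite mule1 -EFinM -EFinD lee_fin mulrDl mul1r lerD2r.
rewrite gt0_powRD// (powR_mulrn _ (ltW rho0)).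
rewrite le_eqVlt; apply/orP; left; apply/eqP.
by field; rewrite gt_eqF// exprn_gt0.
Qed.

Lemma integral_causal_kernel_npow N (theta b : R) : 0 < theta <= 2 -> 0 < b < N%:R ->
  exists2 C : R, 0 < C & forall (t : R) (x : eucl R N), 0 < t ->
  (\int[leb N]_y (causal_kernel theta (eucl_sub x y) t * npow b (eucl_norm y))
     <= (C * t `^ (- (b / theta)))%:E)%E /\
  (\int[leb N]_y (causal_kernel theta (eucl_sub x y) t * npow b (eucl_norm y))
     <= C%:E * npow b (eucl_norm x))%E.
Proof.
move=> th bN; have [C1 C10 hC] := integral_causal_kernel_npow_core th bN.
have th0 : 0 < theta by case/andP: th.
have b0 : 0 < b by case/andP: bN.
have [C2 C20 hC2] := heat_kernel_le N th0.
pose C3 : R := kernel_const N.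
have C30 : 0 <= C3 by rewrite /C3 /kernel_const divr_ge0 ?addr_ge0 ?exprn_ge0.
exists ((C2 * C1 + 1) + (C3 * C1 + 1) * 2 `^ b).
  by rewrite ltr_wpDr// ?mulr_ge0 ?powR_ge0 ?addr_ge0 ?mulr_ge0// ltr_wpDl// mulr_ge0.
move=> t x t0; split.
  (* The length scale of time t: the uniform bound t^(-N/theta) is rho^-N. *)
  pose rho := t `^ (theta^-1).
  have rho0 : 0 < rho by rewrite powR_gt0.
  have := hC C2 rho t x C20 rho0; move=> h; apply: le_trans (h _) _.
    move=> y _; rewrite /causal_kernel t0 lee_fin; apply: le_trans (hC2 _ _ t0) _.
    rewrite ler_wpM2l// /rho -[_ ^+ N]powR_mulrn ?powR_ge0// -powRrM powRN.
    by rewrite [theta^-1 * _]mulrC.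
  rewrite lee_fin /rho -powRrM mulrN [theta^-1 * _]mulrC ler_wpM2r ?powR_ge0//.
  by rewrite lerDl mulr_ge0 ?powR_ge0 ?addr_ge0 ?mulr_ge0.
rewrite {2}/npow; case: eqP => [_|/eqP x0].
  rewrite gt0_muley ?leey// lte_fin.
  by rewrite ltr_wpDr// ?mulr_ge0 ?powR_ge0 ?addr_ge0 ?mulr_ge0// ltr_wpDl// mulr_ge0.
have xp : 0 < eucl_norm x by rewrite lt_neqAle eq_sym x0 eucl_norm_ge0.
(* For |y| < |x|/2 the point x - y has norm at least |x|/2 = rho, so the |x|^-N bound gives rho^-N
   with a constant independent of t. *)
have rho0 : 0 < eucl_norm x / 2 by rewrite divr_gt0.
apply: le_trans (hC C3 _ t x C30 rho0 _) _.
  move=> y /half_norm_le yx; rewrite /causal_kernel t0 lee_fin ler_pdivlMr ?exprn_gt0//.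
  have [_ k0 + _] := kernel_bounds_heat_kernel N th t0.
  move/(_ (eucl_sub x y)); rewrite mulr1; apply: le_trans.
  rewrite mulrC ler_wpM2r//; apply: lerXn2r; rewrite ?nnegrE ?eucl_norm_ge0//.
  exact: ltW.
rewrite -EFinM lee_fin powRM ?(ltW xp)// ?invr_ge0//.
rewrite -[2^-1]powR_inv1// -powRrM mulrN mulN1r opprK.
rewrite [leLHS](_ : _ = (C3 * C1 + 1) * 2 `^ b * eucl_norm x `^ (- b)); last by ring.
apply: ler_wpM2r; first exact: powR_ge0.
by rewrite lerDr addr_ge0// mulr_ge0.
Qed.
End semigroup.

(** * The Duhamel integral *)

Section duhamel.
Context {R : realType}.
Local Notation leb N := (@lebesgue_eucl R N).
Local Notation leb1 := (@lebesgue_measure R).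
Local Open Scope ereal_scope.

Definition slice N (theta : R) (f : eucl R N * measurableTypeR R -> \bar R)
    (z : eucl R N * measurableTypeR R) (s : R) : \bar R :=
  \int[leb N]_y (causal_kernel theta (eucl_sub z.1 y) (z.2 - s) * f (y, s)).

Definition duhamel N (theta : R) (f : eucl R N * measurableTypeR R -> \bar R)
    (z : eucl R N * measurableTypeR R) : \bar R :=
  \int[leb1]_(s in `]0%R, z.2[) slice theta f z s.

Section measurability.
Variables (N : nat) (theta : R) (f : eucl R N * measurableTypeR R -> \bar R).
Hypotheses (th : (0 < theta <= 2)%R) (mf : measurable_fun setT f) (f0 : forall z, 0 <= f z).

Lemma slice_ge0 z s : 0 <= slice theta f z s.
Proof. by apply: integral_ge0 => y _; rewrite mule_ge0 ?causal_kernel_ge0. Qed.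

Lemma measurable_slice_pair :
  measurable_fun setT (fun w : (eucl R N * measurableTypeR R) * measurableTypeR R => slice theta f w.1 w.2).
Proof.
pose F (v : ((eucl R N * measurableTypeR R) * measurableTypeR R) * eucl R N) : \bar R :=
  causal_kernel theta (eucl_sub v.1.1.1 v.2) (v.1.1.2 - v.1.2) * f (v.2, v.1.2).
have m1 : measurable_fun setT (fun v : ((eucl R N * measurableTypeR R) * measurableTypeR R) * eucl R N => v.1.1).
  by apply: measurableT_comp; [exact: measurable_fst|exact: measurable_fst].
have m2 : measurable_fun setT (fun v : ((eucl R N * measurableTypeR R) * measurableTypeR R) * eucl R N => v.1.2).
  by apply: measurableT_comp; [exact: measurable_snd|exact: measurable_fst].
have mF : measurable_fun setT F.
  apply: emeasurable_funM.
    apply: measurable_causal_kernel_comp.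
      apply: measurable_eucl_sub; last exact: measurable_snd.
      by apply: measurableT_comp m1; exact: measurable_fst.
    apply: measurable_funB; last exact: m2.
    by apply: measurableT_comp m1; exact: measurable_snd.
  exact: (measurableT_comp mf (measurable_fun_pair measurable_snd m2)).
apply: (measurable_fun_fubini_tonelli_F (m2 := leb N) F mF) => v.
by rewrite mule_ge0 ?causal_kernel_ge0.
Qed.

Lemma measurable_slice z : measurable_fun setT (slice theta f z).
Proof.
apply: (@measurableT_comp _ _ _ _ _ _
  (fun w : (eucl R N * measurableTypeR R) * measurableTypeR R => slice theta f w.1 w.2) _ (pair z)).
  exact: measurable_slice_pair.
exact: measurable_pair1.
Qed.

Lemma measurable_slice_y (z : eucl R N * measurableTypeR R) (s : R) :
  measurable_fun setT (fun y => causal_kernel theta (eucl_sub z.1 y) (z.2 - s) * f (y, s)).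
Proof.
apply: emeasurable_funM; first exact: measurable_causal_kernel_sub.
by apply: (@measurableT_comp _ _ _ _ _ _ f _ (fun y => (y, s))) => //; exact: measurable_pair2.
Qed.

Lemma duhamel_ge0 z : 0 <= duhamel theta f z.
Proof. by apply: integral_ge0 => s _; exact: slice_ge0. Qed.

Lemma measurable_duhamel : measurable_fun setT (duhamel theta f).
Proof.
(* The moving domain ]0, t[ becomes a cut-off in the integrand, so that Tonelli gives measurability
   in (x, t). *)
pose F (w : (eucl R N * measurableTypeR R) * measurableTypeR R) : \bar R :=
  if (0 < w.2)%R && (w.2 < w.1.2)%R then slice theta f w.1 w.2 else 0.
have mF : measurable_fun setT F.
  apply: measurable_fun_ifT => //; last exact: measurable_slice_pair.
  apply: measurable_and.
    by apply: measurable_fun_ltr => //; exact: measurable_snd.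
  apply: measurable_fun_ltr; first exact: measurable_snd.
  by apply: measurableT_comp; [exact: measurable_snd|exact: measurable_fst].
have F0 w : 0 <= F w by rewrite /F; case: ifP => // _; exact: slice_ge0.
rewrite (_ : duhamel theta f = fubini_F leb1 F); last first.
  apply/funext => z; rewrite /duhamel integral_mkcond; apply: eq_integral => s _.
  by rewrite patchE /F /= mem_setE /= in_itv.
exact: measurable_fun_fubini_tonelli_F.
Qed.
End measurability.

Lemma le_duhamel N (theta : R) (f g : eucl R N * measurableTypeR R -> \bar R) z :
  (0 < theta <= 2)%R -> measurable_fun setT f -> measurable_fun setT g ->
  (forall z, 0 <= f z) -> (forall z, f z <= g z) -> duhamel theta f z <= duhamel theta g z.
Proof.
move=> th mf mg f0 fg; have g0 y : 0 <= g y by exact: le_trans (fg y).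
apply: ge0_le_integral => //.
- by move=> s _; exact: slice_ge0.
- by apply: measurable_funTS; exact: measurable_slice.
- by apply: measurable_funTS; exact: measurable_slice.
- move=> s _; apply: ge0_le_integral => //.
  + by move=> y _; rewrite mule_ge0 ?causal_kernel_ge0.
  + exact: measurable_slice_y.
  + exact: measurable_slice_y.
  + by move=> y _; rewrite lee_wpmul2l ?causal_kernel_ge0.
Qed.

(** The one-dimensional case of the dyadic bound: ]0, t[ lies in the ball of radius t about c. It is
    applied at both ends of the interval, c = 0 and c = t. *)
Lemma integral_time_npow (k : R) : (0 <= k < 1)%R ->
  exists2 C : R, (0 <= C)%R & forall t c : R, (0 < t)%R ->
  (forall s, (0 < s < t)%R -> (`|s - c| < t)%R) ->
  \int[leb1]_(s in `]0%R, t[) npow k `|s - c|%R <= (C * t `^ (1 - k))%:E.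
Proof.
move=> /andP[k0 k1].
have two1 : (2 `^ (k - 1) < 1 :> R)%R.
  rewrite -opprB powRN invf_lt1 ?powR_gt0//.
  have nb : (0 < 1 - k)%R by rewrite subr_gt0.
  by have := @gt0_ltr_powR R _ nb 1%R 2%R; rewrite powR1; apply; rewrite ?nnegrE ?ltr1n.
exists (2 * 2 `^ k / (1 - 2 `^ (k - 1)))%R.
  by rewrite mulr_ge0 ?mulr_ge0 ?powR_ge0// invr_ge0 subr_ge0 ltW.
move=> t c t0 hc.
have mr : measurable_fun setT (fun s : measurableTypeR R => `|s - c|%R).
  by apply: measurableT_comp; [exact: normr_measurable|exact: measurable_funB].
have r0 (s : measurableTypeR R) : (0 <= `|s - c|)%R by [].
have two0 : (0 <= 2 :> R)%R by [].
have k01 : (0 <= k < 1%:R)%R by rewrite k0.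
apply: le_trans (@integral_ball_npow_le R _ _ leb1 _ _ 1 mr r0 two0 (@lebesgue_ball_le R c) k t k01 t0).
have mn : measurable_fun setT (fun s : measurableTypeR R => npow k `|s - c|%R).
  by apply: measurableT_comp mr; exact: measurable_npow.
rewrite [leLHS]integral_mkcond; apply: ge0_le_integral => //.
- by move=> s _; rewrite patchE; case: ifP => // _; exact: npow_ge0.
- by apply/(measurable_restrictT _ _).1 => //; exact: measurable_funTS.
- apply: emeasurable_funM => //; apply/measurable_EFinP; apply: measurable_indic.
  by rewrite -[X in measurable X]setTI; apply: measurable_fun_ltr.
- move=> s _; rewrite patchE; case: ifPn => [|_]; last by rewrite mule_ge0 ?npow_ge0// lee_fin.
  by rewrite mem_setE /= in_itv /= => /hc h; rewrite indicE mem_set// mul1e.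
Qed.
End duhamel.

(** * Bounds on the Duhamel integral *)

Section duhamel_bound.
Context {R : realType}.
Local Notation leb N := (@lebesgue_eucl R N).
Local Notation leb1 := (@lebesgue_measure R).
Local Open Scope ereal_scope.

(* With [f = |y|^-gamma u^p] and u below a multiple of both [|y|^-a] and
   [s^(-a/theta)], this interpolates between the two bounds; see [source_boundE]. *)
Definition source_bound N (theta gamma a M : R) (f : eucl R N * measurableTypeR R -> \bar R) :=
  forall (b : R) (y : eucl R N) (s : R), (gamma <= b <= a + theta)%R -> (0 < s)%R ->
    f (y, s) <= (M * s `^ (- ((a + theta - b) / theta)))%:E * npow b (eucl_norm y).

Section slice_bound.
Variables (N : nat) (theta gamma a M : R) (f : eucl R N * measurableTypeR R -> \bar R).
Hypotheses (th : (0 < theta <= 2)%R) (M0 : (0 < M)%R).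
Hypotheses (mf : measurable_fun setT f) (f0 : forall z, 0 <= f z).
Hypothesis fM : source_bound theta gamma a M f.

Lemma slice_le (b : R) (x : eucl R N) (s t : R) : (gamma <= b <= a + theta)%R -> (0 < s)%R ->
  slice theta f (x, t) s <= (M * s `^ (- ((a + theta - b) / theta)))%:E *
    \int[leb N]_y (causal_kernel theta (eucl_sub x y) (t - s) * npow b (eucl_norm y)).
Proof.
move=> hb s0; set c := (M * _)%R.
have c0 : (0 <= c)%R by rewrite mulr_ge0 ?powR_ge0 ?ltW.
have mh : measurable_fun setT (fun y => causal_kernel theta (eucl_sub x y) (t - s) * npow b (eucl_norm y)).
  by apply: emeasurable_funM; [exact: measurable_causal_kernel_sub|exact: measurable_npow_norm].
have h0 y : 0 <= causal_kernel theta (eucl_sub x y) (t - s) * npow b (eucl_norm y).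
  by rewrite mule_ge0 ?causal_kernel_ge0 ?npow_ge0.
rewrite -(ge0_integralZl (leb N) measurableT mh (fun y _ => h0 y)) ?lee_fin//.
apply: ge0_le_integral => //.
- by move=> y _; rewrite mule_ge0 ?causal_kernel_ge0.
- exact: (measurable_slice_y _ mf (x, t) s).
- exact: emeasurable_funM.
- by move=> y _; rewrite /= muleCA lee_wpmul2l ?causal_kernel_ge0// fM.
Qed.
End slice_bound.

(* With [max a gamma < b1 < min N (a + theta)], the source is bounded through
   [|y|^-b1 s^-k1], whose time singularity is integrable, and close to [s = t]
   through [|y|^-gamma], for which [(t - s)^(-gamma/theta)] is integrable. *)
Lemma duhamel_bound N (theta gamma a : R) : (0 < theta <= 2)%R ->
  (0 < gamma < theta)%R -> (gamma < N%:R)%R -> (0 < a < N%:R)%R ->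
  exists2 C : R, (0 < C)%R & forall M f, (0 < M)%R -> measurable_fun setT f ->
  (forall z, 0 <= f z) -> @source_bound N theta gamma a M f ->
  forall (x : eucl R N) (t : R), (0 < t)%R ->
    duhamel theta f (x, t) <= (C * M * t `^ (- (a / theta)))%:E /\
    duhamel theta f (x, t) <= (C * M)%:E * npow a (eucl_norm x).
Proof.
move=> th /andP[g0 gth] gN /andP[a0 aN]; have th0 : (0 < theta)%R by case/andP: th.
have thn0 : theta != 0%R by rewrite gt_eqF.
(* a < b1 makes k1 < 1; b1 < N is what the kernel estimate needs; gamma <= b1 <= a + theta is the
   range of [source_bound]. *)
have [b1 [ab1 gb1 b1N b1a]] : exists b1 : R,
    [/\ (a < b1)%R, (gamma < b1)%R, (b1 < N%:R)%R & (b1 < a + theta)%R].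
  have : (Num.max a gamma < Num.min N%:R (a + theta))%R.
    by rewrite lt_min !gt_max aN gN ltrDl th0 /=; lra.
  move=> h; exists ((Num.max a gamma + Num.min N%:R (a + theta)) / 2)%R.
  have [h1 h2] := midf_lt h.
  by move: h1 h2; rewrite gt_max lt_min => /andP[-> ->] /andP[-> ->].
have b10 : (0 < b1)%R by exact: lt_trans ab1.
have gbN : (0 < gamma < N%:R)%R by rewrite g0.
have b1bN : (0 < b1 < N%:R)%R by rewrite b10.
have [C1 C10 hC1] := integral_causal_kernel_npow th b1bN.
have [Cg Cg0 hCg] := integral_causal_kernel_npow th gbN.
pose k1 := ((a + theta - b1) / theta)%R; pose kg := ((a + theta - gamma) / theta)%R.
pose k2 := (gamma / theta)%R.
have k101 : (0 <= k1 < 1)%R.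
  by rewrite /k1 divr_ge0 ?(ltW th0) ?subr_ge0 ?(ltW b1a)//= ltr_pdivrMr// mul1r; lra.
have k201 : (0 <= k2 < 1)%R.
  by rewrite /k2 divr_ge0 ?(ltW th0) ?(ltW g0)//= ltr_pdivrMr// mul1r.
have kg0 : (0 <= kg)%R by rewrite /kg divr_ge0 ?(ltW th0)//; lra.
have [T1 T10 hT1] := integral_time_npow k101.
have [T2 T20 hT2] := integral_time_npow k201.
pose D1 := (C1 * 2 `^ (b1 / theta) * T1 + Cg * 2 `^ kg * T2)%R.
have D10 : (0 <= D1)%R by rewrite addr_ge0 ?mulr_ge0 ?powR_ge0 ?(ltW C10) ?(ltW Cg0).
have D20 : (0 <= C1 * T1)%R by rewrite mulr_ge0 ?(ltW C10).
exists (D1 + C1 * T1 + 1)%R; first by rewrite ltr_wpDl// addr_ge0.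
move=> M f M0 mf f0 fM x t t0.
have t20 : (0 < t / 2)%R by rewrite divr_gt0.
have hb1 : (gamma <= b1 <= a + theta)%R by rewrite (ltW gb1) ltW.
have hgg : (gamma <= gamma <= a + theta)%R by rewrite lexx; lra.
have mslice : measurable_fun `]0%R, t[ (slice theta f (x, t)).
  by apply: measurable_funTS; exact: measurable_slice.
have mnp (k c : R) : measurable_fun `]0%R, t[ (fun s : measurableTypeR R => npow k `|s - c|%R).
  apply: measurable_funTS; apply: measurableT_comp; first exact: measurable_npow.
  by apply: measurableT_comp; [exact: normr_measurable|exact: measurable_funB].
have near0 s : (0 < s < t)%R -> (`|s - 0| < t)%R.
  by rewrite subr0 => /andP[s0 st]; rewrite gtr0_norm.
have neart s : (0 < s < t)%R -> (`|s - t| < t)%R.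
  by move=> /andP[s0 st]; rewrite ltr_distl; apply/andP; split; lra.
have npow0 k s : (0 < s)%R -> npow k `|s - 0|%R = (s `^ (- k))%:E.
  by move=> s0; rewrite subr0 gtr0_norm// /npow gt_eqF.
have npowt k s : (s < t)%R -> npow k `|s - t|%R = ((t - s) `^ (- k))%:E.
  by move=> st; rewrite distrC gtr0_norm ?subr_gt0// /npow gt_eqF// subr_gt0.
have Zl (K k c : R) : (0 <= K)%R -> \int[leb1]_(s in `]0%R, t[) (K%:E * npow k `|s - c|%R) =
    K%:E * \int[leb1]_(s in `]0%R, t[) npow k `|s - c|%R.
  move=> K0; apply: ge0_integralZl => //.
  - exact: mnp.
  - by move=> s _; exact: npow_ge0.
have B1 : duhamel theta f (x, t) <= (D1 * M * t `^ (- (a / theta)))%:E.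
  pose K1 := (M * C1 * (t / 2) `^ (- (b1 / theta)))%R.
  pose K2 := (M * Cg * (t / 2) `^ (- kg))%R.
  have K10 : (0 <= K1)%R by rewrite /K1 !mulr_ge0 ?powR_ge0 ?(ltW M0) ?(ltW C10).
  have K20 : (0 <= K2)%R by rewrite /K2 !mulr_ge0 ?powR_ge0 ?(ltW M0) ?(ltW Cg0).
  apply: (@le_trans _ _ (\int[leb1]_(s in `]0%R, t[)
     (K1%:E * npow k1 `|s - 0|%R + K2%:E * npow k2 `|s - t|%R))).
    apply: ge0_le_integral => //.
    - by move=> s _; exact: slice_ge0.
    - by apply: emeasurable_funD; apply: emeasurable_funM => //; exact: mnp.
    - move=> s /=; rewrite in_itv /= => /andP[s0 st].
      rewrite npow0// npowt// -!EFinM -EFinD.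
      have ts : (0 < t - s)%R by rewrite subr_gt0.
      have [st2|st2] := leP s (t / 2)%R.
        apply: le_trans (slice_le th M0 mf f0 fM x t hb1 s0) _.
        apply: (@le_trans _ _ ((M * s `^ (- k1))%:E * (C1 * (t - s) `^ (- (b1 / theta)))%:E)).
          by rewrite lee_wpmul2l ?lee_fin ?mulr_ge0 ?powR_ge0 ?(ltW M0)//; exact: (hC1 _ x ts).1.
        rewrite -EFinM lee_fin -[leLHS]addr0 lerD ?mulr_ge0 ?powR_ge0 ?(ltW M0) ?(ltW Cg0)//.
        rewrite [leLHS](_ : _ = M * C1 * (t - s) `^ (- (b1 / theta)) * s `^ (- k1))%R; last by ring.
        rewrite ler_wpM2r ?powR_ge0// ler_wpM2l ?mulr_ge0 ?(ltW M0) ?(ltW C10)//.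
        by apply: ler_npowR; [rewrite divr_ge0 ?ltW|exact: t20|lra].
      apply: le_trans (slice_le th M0 mf f0 fM x t hgg s0) _.
      apply: (@le_trans _ _ ((M * s `^ (- kg))%:E * (Cg * (t - s) `^ (- k2))%:E)).
        by rewrite lee_wpmul2l ?lee_fin ?mulr_ge0 ?powR_ge0 ?(ltW M0)//; exact: (hCg _ x ts).1.
      rewrite -EFinM lee_fin -[leLHS]add0r lerD ?mulr_ge0 ?powR_ge0 ?(ltW M0) ?(ltW C10)//.
      rewrite [leLHS](_ : _ = M * Cg * s `^ (- kg) * (t - s) `^ (- k2))%R; last by ring.
      rewrite ler_wpM2r ?powR_ge0// ler_wpM2l ?mulr_ge0 ?(ltW M0) ?(ltW Cg0)//.
      by apply: ler_npowR => //; exact: ltW.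
  rewrite ge0_integralD//; last 4 first.
  - by move=> s _; rewrite mule_ge0 ?npow_ge0.
  - by apply: emeasurable_funM => //; exact: mnp.
  - by move=> s _; rewrite mule_ge0 ?npow_ge0.
  - by apply: emeasurable_funM => //; exact: mnp.
  rewrite !Zl//.
  apply: (@le_trans _ _ (K1%:E * (T1 * t `^ (1 - k1))%:E + K2%:E * (T2 * t `^ (1 - k2))%:E)).
    by apply: leeD; apply: lee_wpmul2l; rewrite ?lee_fin//; [exact: hT1|exact: hT2].
  rewrite -!EFinM -EFinD lee_fin le_eqVlt; apply/orP; left; apply/eqP.
  have half (e : R) : ((t / 2) `^ (- e) = 2 `^ e * t `^ (- e))%R.
    by rewrite powRM ?(ltW t0) ?invr_ge0// -[2^-1%R]powR_inv1// -powRrM mulN1r opprK mulrC.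
  have e1 : (t `^ (- (b1 / theta)) * t `^ (1 - k1) = t `^ (- (a / theta)))%R.
    by rewrite -gt0_powRD//; congr (_ `^ _)%R; rewrite /k1; field.
  have e2 : (t `^ (- kg) * t `^ (1 - k2) = t `^ (- (a / theta)))%R.
    by rewrite -gt0_powRD//; congr (_ `^ _)%R; rewrite /kg /k2; field.
  rewrite /K1 /K2 !half.
  transitivity (M * C1 * 2 `^ (b1 / theta) * T1 * (t `^ (- (b1 / theta)) * t `^ (1 - k1)) +
    M * Cg * 2 `^ kg * T2 * (t `^ (- kg) * t `^ (1 - k2)))%R; first by ring.
  by rewrite e1 e2 /D1; ring.
have DM (u : R) : (0 <= u)%R -> (D1 * M * u <= (D1 + C1 * T1 + 1) * M * u)%R.
  move=> u0; rewrite ler_wpM2r// ler_wpM2r ?(ltW M0)//; lra.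
split.
  by apply: le_trans B1 _; rewrite lee_fin DM// powR_ge0.
rewrite /npow; case: eqP => [_|/eqP x0].
  by rewrite gt0_muley ?leey// lte_fin mulr_gt0// ltr_wpDl// addr_ge0.
have xp : (0 < eucl_norm x)%R by rewrite lt_neqAle eq_sym x0 eucl_norm_ge0.
set r := eucl_norm x in xp *.
(* If t > r^theta, then t^(-a/theta) <= r^-a and the time bound suffices. Otherwise b1 serves on the
   whole interval: the kernel bound r^-b1 does not depend on t - s, so nothing is singular at s =
   t. *)
have [tr|rt] := leP t (r `^ theta)%R; last first.
  apply: le_trans B1 _; rewrite -EFinM lee_fin.
  apply: le_trans (DM _ (powR_ge0 _ _)) _; rewrite ler_wpM2l//.
    by rewrite mulr_ge0 ?(ltW M0)// addr_ge0// addr_ge0.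
  have -> : (r `^ (- a) = (r `^ theta) `^ (- (a / theta)))%R.
    by rewrite -powRrM; congr (_ `^ _)%R; field.
  by apply: ler_npowR; [rewrite divr_ge0 ?ltW|exact: powR_gt0|exact: ltW].
pose K := (M * C1 * r `^ (- b1))%R.
have K0 : (0 <= K)%R by rewrite /K !mulr_ge0 ?powR_ge0 ?(ltW M0) ?(ltW C10).
apply: (@le_trans _ _ (\int[leb1]_(s in `]0%R, t[) (K%:E * npow k1 `|s - 0|%R))).
  apply: ge0_le_integral => //.
  - by move=> s _; exact: slice_ge0.
  - by apply: emeasurable_funM => //; exact: mnp.
  - move=> s /=; rewrite in_itv /= => /andP[s0 st].
    have ts : (0 < t - s)%R by rewrite subr_gt0.
    rewrite npow0// -EFinM.
    apply: le_trans (slice_le th M0 mf f0 fM x t hb1 s0) _.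
    apply: (@le_trans _ _ ((M * s `^ (- k1))%:E * (C1%:E * npow b1 r))).
      by rewrite lee_wpmul2l ?lee_fin ?mulr_ge0 ?powR_ge0 ?(ltW M0)//; exact: (hC1 _ x ts).2.
    rewrite /npow gt_eqF// -!EFinM lee_fin le_eqVlt; apply/orP; left; apply/eqP.
    by rewrite /K; ring.
rewrite Zl//.
apply: (@le_trans _ _ (K%:E * (T1 * t `^ (1 - k1))%:E)).
  by apply: lee_wpmul2l; rewrite ?lee_fin//; exact: hT1.
rewrite -!EFinM lee_fin.
have e3 : (r `^ (- b1) * (r `^ theta) `^ (1 - k1) = r `^ (- a))%R.
  by rewrite -powRrM -gt0_powRD//; congr (_ `^ _)%R; rewrite /k1; field.
apply: (@le_trans _ _ (C1 * T1 * M * (r `^ (- b1) * (r `^ theta) `^ (1 - k1)))%R).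
  rewrite [leLHS](_ : _ = C1 * T1 * M * (r `^ (- b1) * t `^ (1 - k1)))%R; last by rewrite /K; ring.
  rewrite ler_wpM2l ?mulr_ge0 ?(ltW M0) ?(ltW C10)// ler_wpM2l ?powR_ge0//.
  apply: ge0_ler_powR => //; rewrite ?nnegrE ?powR_ge0 ?(ltW t0)//.
  by case/andP: k101 => _ k11; rewrite subr_ge0 ltW.
rewrite e3 ler_wpM2r ?powR_ge0// ler_wpM2r ?(ltW M0)//; lra.
Qed.
End duhamel_bound.

(** * Monotone iteration *)

Section iteration.
Context {R : realType}.
Local Notation leb N := (@lebesgue_eucl R N).
Local Notation leb1 := (@lebesgue_measure R).
Local Open Scope ereal_scope.

(** The factor may be [+oo], as is the weight |y|^-gamma at the origin; the cases producing 0 times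
    [+oo] are therefore set apart before multiplying limits. *)
Lemma mule_limn (c : \bar R) (w : nat -> \bar R) : 0 <= c -> (forall n, 0 <= w n) ->
  nondecreasing_seq w -> c * limn w = limn (fun n => c * w n).
Proof.
move=> c0 w0 nw; have cw : w @ \oo --> limn w by exact: ereal_nondecreasing_is_cvgn.
have [l0|l0] := eqVneq (limn w) 0.
  rewrite l0 mule0 (_ : (fun n => _) = fun=> 0) ?lim_cst//.
  apply/funext => n; have : w n <= 0.
    by rewrite -l0 (cvg_lim _ (ereal_nondecreasing_cvgn nw))//; apply: ereal_sup_ubound; exists n.
  by move=> wn; rewrite (_ : w n = 0) ?mule0//; apply/eqP; rewrite eq_le wn w0.
have [->|c00] := eqVneq c 0.
  by under eq_fun do rewrite mul0e; rewrite mul0e lim_cst.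
apply/esym/cvg_lim => //; apply: cvgeM => //; last exact: cvg_cst.
by rewrite mule_defE (negbTE l0) (negbTE c00).
Qed.

(** Includes the limit [+oo], and uses monotonicity only: with L the limit of the powers, each w n
    is at most L^(1/p), hence so is limn w, and raising to the power p gives the nontrivial
    inequality. *)
Lemma poweR_limn (p : R) (w : nat -> \bar R) : (0 < p)%R -> (forall n, 0 <= w n) ->
  nondecreasing_seq w -> poweR (limn w) p = limn (fun n => poweR (w n) p).
Proof.
move=> p0 w0 nw.
have mono (q : R) (x y : \bar R) : (0 < q)%R -> 0 <= x -> x <= y -> poweR x q <= poweR y q.
  move=> q0 x0 xy; apply: gt0_ler_poweR => //; rewrite ?in_itv /= ?leey ?andbT//; first exact: ltW.
  exact: le_trans xy.
have npw : nondecreasing_seq (fun n => poweR (w n) p).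
  by move=> m n mn; apply: (mono) => //; exact: nw.
have ubw n : w n <= limn w.
  by rewrite (cvg_lim _ (ereal_nondecreasing_cvgn nw))//; apply: ereal_sup_ubound; exists n.
have cpw := ereal_nondecreasing_is_cvgn npw.
have inv (x : \bar R) (q r : R) : 0 <= x -> (q * r = 1)%R -> poweR (poweR x q) r = x.
  by move=> x0 qr; rewrite -poweRrM qr poweRe1.
apply/eqP; rewrite eq_le; apply/andP; split; last first.
  by apply: lime_le => //; apply: nearW => n; exact: mono.
set L := limn (fun n => poweR (w n) p).
have ubL n : poweR (w n) p <= L.
  by rewrite /L (cvg_lim _ (ereal_nondecreasing_cvgn npw))//; apply: ereal_sup_ubound; exists n.
have L0 : 0 <= L by apply: le_trans (ubL 0%N); exact: poweR_ge0.
have pV : (p^-1 * p = 1)%R by rewrite mulVf// gt_eqF.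
rewrite -(inv L _ _ L0 pV); apply: (mono) => //.
  exact: le_trans (w0 0%N) (ubw 0%N).
apply: lime_le; first exact: ereal_nondecreasing_is_cvgn.
apply: nearW => n; rewrite -(inv (w n) p p^-1%R)//; last by rewrite mulrC.
by apply: (mono) => //; rewrite ?invr_gt0// poweR_ge0.
Qed.

Lemma duhamel_limn N (theta : R) (f_ : nat -> eucl R N * measurableTypeR R -> \bar R) z :
  (0 < theta <= 2)%R -> (forall n, measurable_fun setT (f_ n)) ->
  (forall n w, 0 <= f_ n w) -> (forall w, nondecreasing_seq (f_ ^~ w)) ->
  duhamel theta (fun w => limn (f_ ^~ w)) z = limn (fun n => duhamel theta (f_ n) z).
Proof.
move=> th mf f0 nf.
rewrite /duhamel -monotone_convergence//; last 3 first.
- by move=> n; apply: measurable_funTS; exact: measurable_slice.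
- by move=> n s _; exact: slice_ge0.
- move=> s _ m n mn; apply: ge0_le_integral => //.
  + by move=> y _; rewrite mule_ge0 ?causal_kernel_ge0.
  + exact: measurable_slice_y.
  + exact: measurable_slice_y.
  + by move=> y _; rewrite lee_wpmul2l ?causal_kernel_ge0//; exact: nf.
apply: eq_integral => s _; rewrite /slice -monotone_convergence//; last 3 first.
- by move=> n; exact: measurable_slice_y.
- by move=> n y _; rewrite mule_ge0 ?causal_kernel_ge0.
- by move=> y _ m n mn; rewrite lee_wpmul2l ?causal_kernel_ge0//; exact: nf.
by apply: eq_integral => y _; rewrite mule_limn ?causal_kernel_ge0.
Qed.

Definition source N (gamma p : R) (u : eucl R N * measurableTypeR R -> \bar R) z : \bar R :=
  npow gamma (eucl_norm z.1) * poweR (u z) p.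

Lemma source_ge0 N gamma p (u : eucl R N * measurableTypeR R -> \bar R) z : 0 <= source gamma p u z.
Proof. by rewrite mule_ge0 ?npow_ge0// poweR_ge0. Qed.

Lemma measurable_source N gamma p (u : eucl R N * measurableTypeR R -> \bar R) :
  measurable_fun setT u -> measurable_fun setT (source gamma p u).
Proof.
move=> mu; apply: emeasurable_funM.
  by apply: (measurableT_comp (@measurable_npow_norm R N gamma)); exact: measurable_fst.
by apply: (measurableT_comp (@measurable_poweR R p)).
Qed.

Lemma powR_interp (v X Y p1 p2 : R) : (0 <= v)%R -> (v <= X)%R -> (v <= Y)%R ->
  (0 <= p1)%R -> (0 <= p2)%R -> (0 < p1 + p2)%R ->
  (v `^ (p1 + p2) <= X `^ p1 * Y `^ p2)%R.
Proof.
move=> v0 vX vY p10 p20 p12; have [->|vn] := eqVneq v 0%R.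
  by rewrite powR0 ?gt_eqF// mulr_ge0 ?powR_ge0.
have vp : (0 < v)%R by rewrite lt_neqAle eq_sym vn.
rewrite gt0_powRD// ler_pM ?powR_ge0//; apply: ge0_ler_powR => //; rewrite nnegrE; exact: le_trans v0 _.
Qed.

Lemma source_boundE N (theta gamma p a M : R) (u : eucl R N * measurableTypeR R -> \bar R) :
  (0 < theta)%R -> (0 < gamma)%R -> (1 < p)%R -> (0 < a)%R ->
  (gamma + a * p = a + theta)%R -> (0 < M)%R -> (forall z, 0 <= u z) ->
  (forall y s, (0 < s)%R -> u (y, s) <= (M * s `^ (- (a / theta)))%:E /\
     u (y, s) <= M%:E * npow a (eucl_norm y)) ->
  source_bound theta gamma a (M `^ p)%R (source gamma p u).
Proof.
move=> th0 g0 p1 a0 hap M0 u0 hu b y s /andP[gb ba] s0; have [h1 h2] := hu y s s0.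
rewrite /source /=; have [y0|y0] := eqVneq (eucl_norm y) 0%R.
  rewrite {2}/npow y0 eqxx gt0_muley ?leey// lte_fin mulr_gt0 ?powR_gt0//.
move: h2; rewrite /npow (negbTE y0) -EFinM => h2.
have yp : (0 < eucl_norm y)%R by rewrite lt_neqAle eq_sym y0 eucl_norm_ge0.
have ufin : u (y, s) \is a fin_num.
  by rewrite ge0_fin_numE// (le_lt_trans h2)// ltry.
move: h1 h2 (u0 (y, s)); rewrite -(fineK ufin) !lee_fin.
set v := fine _ => h1 h2 v0.
(* The p factors of u are shared: p1' of them use |y|^-a, so that gamma + a p1' = b, and the
   remaining p2' use s^(-a/theta). That p2' >= 0 is the condition b <= a + theta = gamma + a p. *)
pose p1' := ((b - gamma) / a)%R; pose p2' := (p - p1')%R.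
have p10 : (0 <= p1')%R by rewrite divr_ge0 ?subr_ge0// ltW.
have p20 : (0 <= p2')%R by rewrite /p2' subr_ge0 /p1' ler_pdivrMr// mulrC; lra.
have p12 : (p1' + p2' = p)%R by rewrite /p2'; ring.
have := @powR_interp v _ _ p1' p2' v0 h2 h1 p10 p20.
rewrite p12 => /(_ (lt_trans ltr01 p1)) h.
apply: (le_trans (ler_wpM2l (powR_ge0 _ _) h)).
rewrite !powRM ?powR_ge0 ?(ltW M0)// -!powRrM.
rewrite le_eqVlt; apply/orP; left; apply/eqP.
have e1 : (M `^ p = M `^ p1' * M `^ p2')%R by rewrite -gt0_powRD// p12.
have e2 : (eucl_norm y `^ (- b) = eucl_norm y `^ (- gamma) * eucl_norm y `^ (- a * p1'))%R.
  by rewrite -gt0_powRD//; congr (_ `^ _)%R; rewrite /p1'; field; rewrite gt_eqF.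
have e3 : (- ((a + theta - b) / theta) = - (a / theta) * p2')%R.
  have e3 : (a + theta - b = a * p2')%R.
    by rewrite /p2' /p1' mulrBr [(a * (_ / a))%R]mulrCA divff ?gt_eqF// -hap; ring.
  by rewrite e3; ring.
by rewrite e1 e2 e3; ring.
Qed.
End iteration.

(** * Existence of a solution for Borel measurable data *)

Section existence.
Context {R : realType}.
Local Notation leb N := (@lebesgue_eucl R N).
Local Open Scope ereal_scope.

Definition heat_flow N (theta : R) (m : eucl R N -> \bar R) (z : eucl R N * measurableTypeR R) : \bar R :=
  \int[leb N]_y (causal_kernel theta (eucl_sub z.1 y) z.2 * m y).

Lemma heat_flow_ge0 N theta (m : eucl R N -> \bar R) z :
  (0 < theta <= 2)%R -> (forall x, 0 <= m x) -> 0 <= heat_flow theta m z.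
Proof. by move=> th m0; apply: integral_ge0 => y _; rewrite mule_ge0 ?causal_kernel_ge0. Qed.

Lemma measurable_heat_flow N theta (m : eucl R N -> \bar R) :
  (0 < theta <= 2)%R -> measurable_fun setT m -> (forall x, 0 <= m x) ->
  measurable_fun setT (heat_flow theta m).
Proof.
move=> th mm m0.
pose F (v : (eucl R N * measurableTypeR R) * eucl R N) : \bar R :=
  causal_kernel theta (eucl_sub v.1.1 v.2) v.1.2 * m v.2.
have mF : measurable_fun setT F.
  apply: emeasurable_funM; last exact: (measurableT_comp mm measurable_snd).
  apply: measurable_causal_kernel_comp.
    apply: measurable_eucl_sub; last exact: measurable_snd.
    exact: (measurableT_comp measurable_fst measurable_fst).
  exact: (measurableT_comp measurable_snd measurable_fst).
apply: (measurable_fun_fubini_tonelli_F (m2 := leb N) F mF) => v.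
by rewrite mule_ge0 ?causal_kernel_ge0.
Qed.

Lemma mild_solution_exists N (theta gamma p : R) : (0 < theta <= 2)%R ->
  (0 < gamma < theta)%R -> (gamma < N%:R)%R -> (1 < p)%R ->
  ((theta - gamma) / (p - 1) < N%:R)%R ->
  exists2 c : R, (0 < c)%R & forall m : eucl R N -> \bar R,
  measurable_fun setT m ->
  (forall x, 0 <= m x <= c%:E * npow ((theta - gamma) / (p - 1)) (eucl_norm x)) ->
  exists u : eucl R N * measurableTypeR R -> \bar R,
    [/\ measurable_fun setT u, forall z, 0 <= u z &
        forall x t, (0 < t)%R -> u (x, t) < +oo /\
          u (x, t) = heat_flow theta m (x, t) + duhamel theta (source gamma p u) (x, t)].
Proof.
move=> th gth gN p1 aN; set a := ((theta - gamma) / (p - 1))%R in aN *.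
have th0 : (0 < theta)%R by case/andP: th.
have g0 : (0 < gamma)%R by case/andP: gth.
have p10 : (0 < p - 1)%R by rewrite subr_gt0.
have p0 : (0 < p)%R by exact: lt_trans p1.
have a0 : (0 < a)%R by rewrite divr_gt0// subr_gt0; case/andP: gth.
have hap : (gamma + a * p = a + theta)%R by rewrite /a; field; rewrite gt_eqF.
have abN : (0 < a < N%:R)%R by rewrite a0.
have [C1 C10 hC1] := integral_causal_kernel_npow th abN.
have [C2 C20 hC2] := duhamel_bound th gth gN abN.
pose M := ((2 * C2)^-1 `^ (p - 1)^-1)%R.
have M0 : (0 < M)%R by rewrite powR_gt0// invr_gt0 mulr_gt0.
(* The smallness condition: c C1 = M/2 and C2 M^p = M/2. *)
have MC : (C2 * M `^ p = M / 2)%R.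
  have -> : (M `^ p = M * M `^ (p - 1))%R.
    by rewrite -{2}(powRr1 (ltW M0)) -gt0_powRD//; congr (_ `^ _)%R; ring.
  rewrite /M -[in X in (_ * (_ * X))%R]powRrM mulVf ?gt_eqF// powRr1; last first.
    by rewrite invr_ge0 mulr_ge0// ltW.
  by field; rewrite gt_eqF.
exists (M / (2 * C1))%R; first by rewrite divr_gt0// mulr_gt0.
set c := (M / (2 * C1))%R => m mm hm.
have c0 : (0 < c)%R by rewrite divr_gt0// mulr_gt0.
have cC1 : (c * C1 = M / 2)%R by rewrite /c; field; rewrite gt_eqF.
have m0 x : 0 <= m x by case/andP: (hm x).
pose S := heat_flow theta m.
have mS : measurable_fun setT S by exact: measurable_heat_flow.
have S0 z : 0 <= S z by exact: heat_flow_ge0.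
have Sle x t : (0 < t)%R -> S (x, t) <= (M / 2 * t `^ (- (a / theta)))%:E /\
    S (x, t) <= (M / 2)%:E * npow a (eucl_norm x).
  move=> t0; have [h1 h2] := hC1 t x t0.
  have hS : S (x, t) <= c%:E * \int[leb N]_y (causal_kernel theta (eucl_sub x y) t * npow a (eucl_norm y)).
    have mh : measurable_fun setT (fun y => causal_kernel theta (eucl_sub x y) t * npow a (eucl_norm y)).
      by apply: emeasurable_funM; [exact: measurable_causal_kernel_sub|exact: measurable_npow_norm].
    have h0 y : 0 <= causal_kernel theta (eucl_sub x y) t * npow a (eucl_norm y).
      by rewrite mule_ge0 ?causal_kernel_ge0 ?npow_ge0.
    rewrite -(ge0_integralZl (leb N) measurableT mh (fun y _ => h0 y)) ?lee_fin ?(ltW c0)//.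
    apply: ge0_le_integral => //.
    - by move=> y _; rewrite mule_ge0 ?causal_kernel_ge0.
    - by apply: emeasurable_funM => //; exact: measurable_causal_kernel_sub.
    - exact: emeasurable_funM.
    - move=> y _; rewrite muleCA lee_wpmul2l ?causal_kernel_ge0//.
      by case/andP: (hm y).
  split; apply: (le_trans hS).
    apply: (@le_trans _ _ (c%:E * (C1 * t `^ (- (a / theta)))%:E)).
      by rewrite lee_wpmul2l// lee_fin ltW.
    by rewrite -EFinM mulrA cC1.
  apply: (@le_trans _ _ (c%:E * (C1%:E * npow a (eucl_norm x)))).
    by rewrite lee_wpmul2l// lee_fin ltW.
  by rewrite muleA -EFinM cC1.
pose step u z : \bar R := S z + duhamel theta (source gamma p u) z.
pose u_ n := iter n step (fun=> 0).
have [mu u0] : (forall n, measurable_fun setT (u_ n)) /\ (forall n z, 0 <= u_ n z).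
  apply: all_and2; elim=> [|n [IH1 IH2]]; first by split => //; exact: measurable_cst.
  have ms := measurable_source gamma p IH1; split.
    by apply: emeasurable_funD => //; apply: measurable_duhamel => // z; exact: source_ge0.
  by move=> z; rewrite adde_ge0// duhamel_ge0// => w; exact: source_ge0.
have source_le u v : (forall z, 0 <= u z) -> (forall z, u z <= v z) ->
    forall z, source gamma p u z <= source gamma p v z.
  move=> uu0 uv z; rewrite lee_wpmul2l ?npow_ge0//; apply: gt0_ler_poweR; first exact: ltW.
  - by rewrite in_itv /= uu0 leey.
  - by rewrite in_itv /= leey (le_trans (uu0 z)).
  - exact: uv.
have ndu1 n z : u_ n z <= u_ n.+1 z.
  elim: n z => [|n IH] z; first exact: u0.
  apply: leeD; first exact: lexx.
  apply: (le_duhamel _ th (measurable_source gamma p (mu n))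
    (measurable_source gamma p (mu n.+1)) (source_ge0 _ _ _)).
  exact: source_le.
have ndu z : nondecreasing_seq (u_ ^~ z) by apply/nondecreasing_seqP => n; exact: ndu1.
have ule n x t : (0 < t)%R -> u_ n (x, t) <= (M * t `^ (- (a / theta)))%:E /\
    u_ n (x, t) <= M%:E * npow a (eucl_norm x).
  elim: n x t => [|n IH] x t t0.
    by rewrite lee_fin mulr_ge0 ?powR_ge0 ?(ltW M0)// mule_ge0 ?npow_ge0// lee_fin ltW.
  have [s1 s2] := Sle x t t0.
  have Mp0 : (0 < M `^ p)%R by rewrite powR_gt0.
  have [d1 d2] := hC2 _ _ Mp0 (measurable_source gamma p (mu n)) (source_ge0 _ _ _)
    (source_boundE th0 g0 p1 a0 hap M0 (u0 n) IH) x t t0.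
  split.
    apply: le_trans (leeD s1 d1) _.
    by rewrite MC -EFinD lee_fin -mulrDl -splitr.
  apply: le_trans (leeD s2 d2) _.
  rewrite MC -ge0_muleDl ?lee_fin ?divr_ge0 ?(ltW M0)//.
  by rewrite -EFinD -splitr.
pose u z := limn (u_ ^~ z).
have cu z : u_ ^~ z @ \oo --> u z by exact: ereal_nondecreasing_is_cvgn.
have uu0 z : 0 <= u z.
  by apply: lime_ge; [exact: ereal_nondecreasing_is_cvgn|exact: nearW].
exists u; split => //.
  by apply: (emeasurable_fun_cvg u_ u mu) => z _; exact: cu.
move=> x t t0; split.
  (* The time bound gives finiteness at every x, the origin included. *)
  apply: (@le_lt_trans _ _ (M * t `^ (- (a / theta)))%:E); last by rewrite ltry.
  apply: lime_le; first exact: ereal_nondecreasing_is_cvgn.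
  by apply: nearW => n; exact: (ule n x t t0).1.
have srcE : source gamma p u = fun z => limn (fun n => source gamma p (u_ n) z).
  apply/funext => z; rewrite /source poweR_limn// mule_limn ?npow_ge0//.
    by move=> n; exact: poweR_ge0.
  move=> i j ij; apply: gt0_ler_poweR; first exact: ltW.
  - by rewrite in_itv /= u0 leey.
  - by rewrite in_itv /= u0 leey.
  - exact: ndu.
have nds z : nondecreasing_seq (fun n => source gamma p (u_ n) z).
  by move=> i j ij; apply: source_le => // w; exact: ndu.
have ms n : measurable_fun setT (source gamma p (u_ n)) by exact: measurable_source.
have ndd z : nondecreasing_seq (fun n => duhamel theta (source gamma p (u_ n)) z).
  move=> i j ij; apply: le_duhamel => // w; first exact: source_ge0.
  exact: nds.
rewrite srcE duhamel_limn//; last by move=> n w; exact: source_ge0.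
have cd := ereal_nondecreasing_is_cvgn (ndd (x, t)).
have c1 : u_ n.+1 (x, t) @[n --> \oo] --> u (x, t).
  by rewrite (cvg_shiftS (u_ ^~ (x, t))).
apply: (cvg_unique _ c1) => //; apply: cvgeD => //; last exact: cvg_cst.
by rewrite ge0_adde_def// inE//; apply: lime_ge => //; apply: nearW => n; apply: duhamel_ge0 => // w; exact: source_ge0.
Qed.
End existence.

(** * Lebesgue measurable data *)

Section lebesgue_measurable.
Context {R : realType}.
Local Open Scope ereal_scope.

Section completion.
Context d (T : measurableType d).
Variable m : {measure set T -> \bar R}.

Let almost (G : set T) := exists B Z, [/\ measurable B, measurable Z, m Z = 0 &
  forall x, ~ Z x -> (G x <-> B x)].

(** The sets that agree with a measurable set off a measurable null set form a sigma-algebra, and it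
    contains the generators of the completion. *)
Lemma completed_measurable_almost (G : set T) :
  (completed_algebra_gen m).-sigma.-measurable G ->
  exists B Z, [/\ measurable B, measurable Z, m Z = 0 & forall x, ~ Z x -> (G x <-> B x)].
Proof.
suff : (completed_algebra_gen m).-sigma.-measurable `<=` almost by exact.
apply: smallest_sub => /=; last first.
  move=> _ [A mA [N [Z [mZ Z0 NZ]] <-]]; exists A, Z; split => // x nZ.
  by split => [[//|/NZ]//|]; left.
split.
- by exists set0, set0; rewrite measure0.
- move=> {}G [B [Z [mB mZ Z0 GB]]]; exists (~` B), Z; split => //.
    exact: measurableC.
  move=> x nZ; have [h1 h2] := GB x nZ; rewrite setTD.
  by split => h; contra: h => ?; [exact: h2|exact: h1].
- move=> F aF; have /choice[B aB] := aF; have /choice[Z aZ] := aB.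
  exists (\bigcup_k B k), (\bigcup_k Z k); split.
  + by apply: bigcupT_measurable => k; case: (aZ k).
  + by apply: bigcupT_measurable => k; case: (aZ k).
  + apply/eqP; rewrite -measure_le0.
    have : m.-negligible (\bigcup_k Z k).
      by apply: negligible_bigcup => k; exists (Z k); case: (aZ k) => ? ? ? _; split.
    move=> [A [mA A0 ZA]]; rewrite -A0; apply: le_measure => //; rewrite inE//.
    by apply: bigcupT_measurable => k; case: (aZ k).
  + move=> x nZ; have nZk k : ~ Z k x by move=> h; apply: nZ; exists k.
    by split => -[k _ h]; exists k => //; case: (aZ k) => _ _ _ /(_ x (nZk k))[h1 h2]; [exact: h1|exact: h2].
Qed.

(** The inequality g <= f holds everywhere, not just almost everywhere, so that the pointwise bound
    on the datum is inherited by its Borel version. *)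
Lemma completed_measurable_fun_borel (f : T -> \bar R) :
  completed_measurable_fun m setT f -> (forall x, 0 <= f x) ->
  exists g Z, [/\ measurable_fun setT g, measurable Z, m Z = 0,
    forall x, 0 <= g x <= f x & forall x, ~ Z x -> f x = g x].
Proof.
move=> mf f0.
(* g is the supremum over nonnegative rationals q of [q \1_(B_q)], where [B_q] is a
   measurable version of [{f > q}]. *)
pose r (n : nat) : R := if unpickle n is Some q then Num.max (ratr q) 0%R else 0%R.
have r0 n : (0 <= r n)%R by rewrite /r; case: unpickle => // q; rewrite le_max lexx orbT.
have mG n : (completed_algebra_gen m).-sigma.-measurable [set x | (r n)%:E < f x].
  have := mf measurableT `](r n)%:E, +oo[%classic (emeasurable_itv _).
  rewrite setTI; congr (measurable _); apply/seteqP; split => x /=; rewrite in_itv /= andbT//.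
have /choice[B aB] := fun n => completed_measurable_almost (mG n).
have /choice[Z aZ] := aB.
pose ZZ := \bigcup_k Z k.
have mZZ : measurable ZZ by apply: bigcupT_measurable => k; case: (aZ k).
have ZZ0 : m ZZ = 0.
  have : m.-negligible ZZ by apply: negligible_bigcup => k; exists (Z k); case: (aZ k) => ? ? ? _; split.
  move=> [A [mA A0 ZA]]; apply/eqP; rewrite -measure_le0 -A0; apply: le_measure => //; rewrite inE//.
(* Removing the common null set [ZZ] from each [B n] is what keeps g below f at every point. *)
pose h n x : \bar R := (r n * \1_(B n `\` ZZ) x)%:E.
have mh n : measurable_fun setT (h n).
  apply/measurable_EFinP; apply: measurable_funM => //; apply: measurable_indic.
  by apply: measurableD => //; case: (aZ n).
have h0 n x : 0 <= h n x by rewrite lee_fin mulr_ge0.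
pose g x := esups (h ^~ x) 0%N.
have hg n x : h n x <= g x by apply: ereal_sup_ubound; exists n.
exists g, ZZ; split => //.
- exact: measurable_fun_esups.
- move=> x; apply/andP; split; first exact: le_trans (h0 0%N x) (hg 0%N x).
  apply: ge_ereal_sup => _ [n _ <-]; rewrite /h indicE.
  case: (boolP (x \in _)) => [/set_mem[Bx nZ]|_]; last by rewrite mulr0.
  have nZn : ~ Z n x by move=> zx; apply: nZ; exists n.
  rewrite mulr1; apply/ltW; case: (aZ n) => _ _ _ /(_ x nZn)[_]; exact.
- move=> x nZ; apply/eqP; rewrite eq_le; apply/andP; split; last first.
    apply: ge_ereal_sup => _ [n _ <-]; rewrite /h indicE.
    case: (boolP (x \in _)) => [/set_mem[Bx nZ']|_]; last by rewrite mulr0.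
    have nZn : ~ Z n x by move=> zx; apply: nZ; exists n.
    rewrite mulr1; apply/ltW; case: (aZ n) => _ _ _ /(_ x nZn)[_]; exact.
  rewrite leNgt; apply/negP => gf.
  have g0 : 0 <= g x by exact: le_trans (h0 0%N x) (hg 0%N x).
  have [q [q1 q2]] : exists q : rat, g x < (ratr q)%:E /\ (ratr q)%:E < f x.
    move: g0 gf; case: (g x) => [u| |]//; last by move=> _; rewrite ltNge leey.
    move=> _; case: (f x) => [v| |]//.
      by rewrite lte_fin => /rat_in_itvoo[q]; rewrite in_itv /= => /andP[? ?]; exists q; rewrite !lte_fin.
    move=> _; have : (u < u + 1)%R by rewrite ltrDl.
    by move=> /rat_in_itvoo[q]; rewrite in_itv /= => /andP[? ?]; exists q; rewrite !lte_fin ltry.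
  have rq : r (pickle q) = ratr q.
    by rewrite /r pickleK; apply/max_idPl; rewrite -lee_fin (le_trans g0)// ltW.
  have := hg (pickle q) x; rewrite /h indicE mem_set ?mulr1 ?rq; first by rewrite leNgt q1.
  have nZn : ~ Z (pickle q) x by move=> zx; apply: nZ; exists (pickle q).
  by split => //; case: (aZ (pickle q)) => _ _ _ /(_ x nZn)[+ _]; apply; rewrite /= rq.
Qed.

Import HBNNSimple.

(** Meant for a datum that is only Lebesgue measurable, whose integral is a supremum over Borel
    simple functions below it. Multiplying such a function by the indicator of the complement of Z
    preserves its integral and puts it below g. *)
Lemma ge0_integral_ae_le (f g : T -> \bar R) (Z : set T) :
  (forall x, 0 <= f x) -> (forall x, 0 <= g x) ->
  measurable Z -> m Z = 0 -> (forall x, ~ Z x -> f x = g x) ->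
  \int[m]_x f x <= \int[m]_x g x.
Proof.
move=> f0 g0 mZ Z0 fg; rewrite ge0_integralTE//.
apply: ge_ereal_sup => _ [h hf <-].
have mZc : measurable (~` Z) by exact: measurableC.
pose k := mul_nnsfun h (indic_nnsfun R mZc).
have kE x : k x = (h x * \1_(~` Z) x)%R by [].
have -> : sintegral m h = sintegral m k.
  rewrite -!integralT_nnsfun.
  apply: ae_eq_integral => //; [exact/measurable_EFinP|exact/measurable_EFinP|].
  exists Z; split => // x nx; apply: contrapT => nZx; apply: nx => _.
  have kx : h x = k x by rewrite kE indicE mem_set// mulr1.
  exact: (congr1 EFin kx).
rewrite ge0_integralTE//; apply: ereal_sup_ubound; exists k => // x.
have -> : (k x)%:E = (h x)%:E * (\1_(~` Z) x)%:E by rewrite -EFinM.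
rewrite indicE; case: (boolP (x \in _)) => [/set_mem nZ|_]; last by rewrite mule0.
by rewrite mule1 -fg.
Qed.

Lemma ge0_integral_ae_eq (f g : T -> \bar R) (Z D : set T) :
  (forall x, 0 <= f x) -> (forall x, 0 <= g x) ->
  measurable Z -> m Z = 0 -> (forall x, ~ Z x -> f x = g x) ->
  \int[m]_(x in D) f x = \int[m]_(x in D) g x.
Proof.
move=> f0 g0 mZ Z0 fg; rewrite !(integral_mkcond D).
have fD0 x : 0 <= (f \_ D) x by rewrite patchE; case: ifP.
have gD0 x : 0 <= (g \_ D) x by rewrite patchE; case: ifP.
have fgD x : ~ Z x -> (f \_ D) x = (g \_ D) x by move=> /fg; rewrite !patchE => ->.
apply/eqP; rewrite eq_le; apply/andP; split; apply: (@ge0_integral_ae_le _ _ Z) => //.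
by move=> x /fgD.
Qed.
End completion.

Section density.
Context d (T : measurableType d).
Variables (m : {measure set T -> \bar R}) (g : T -> \bar R).
Hypotheses (mg : measurable_fun setT g) (g0 : forall x, 0 <= g x).

Let nu (A : set T) : \bar R := \int[m]_(x in A) g x.

Let nu0 : nu set0 = 0. Proof. exact: integral_set0. Qed.

Let nu_ge0 A : 0 <= nu A. Proof. exact: integral_ge0. Qed.

Let nu_sigma_additive : semi_sigma_additive nu.
Proof.
move=> F mF tF mUF; rewrite /nu ge0_integral_bigcup//; last exact: measurable_funTS.
by apply: is_cvg_nneseries => n _ _; exact: integral_ge0.
Qed.

HB.instance Definition _ := isMeasure.Build _ _ _ nu nu0 nu_ge0 nu_sigma_additive.

Import HBNNSimple.

(** In the notion of solution the measure of the datum is a bare set function. For a Borel density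
    it carries the measure structure built above, and the formula extends from simple functions to f
    by monotone convergence on both sides. *)
Lemma ge0_integral_density (f : T -> \bar R) :
  measurable_fun setT f -> (forall x, 0 <= f x) ->
  \int[nu]_x f x = \int[m]_x (f x * g x).
Proof.
move=> mf f0; pose f_ := nnsfun_approx measurableT mf.
have f_cvg x : EFin \o f_ ^~ x @ \oo --> f x by exact: cvg_nnsfun_approx.
have nf x : nondecreasing_seq (fun n => (f_ n x)%:E).
  by move=> i j ij; rewrite lee_fin; exact/lefP/nd_nnsfun_approx.
have mf_ n : measurable_fun setT (fun x => (f_ n x)%:E) by exact/measurable_EFinP.
transitivity (limn (fun n => \int[nu]_x (f_ n x)%:E)).
  rewrite -monotone_convergence//; last by move=> n x _; rewrite lee_fin.
  by apply: eq_integral => x _; apply/esym/cvg_lim => //; exact: f_cvg.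
transitivity (limn (fun n => \int[m]_x ((f_ n x)%:E * g x))); last first.
  rewrite -monotone_convergence//; last 3 first.
  - by move=> n; exact: emeasurable_funM.
  - by move=> n x _; rewrite mule_ge0// lee_fin.
  - by move=> x _ i j ij; rewrite lee_wpmul2r//; exact: nf.
  apply: eq_integral => x _; rewrite muleC -(cvg_lim _ (f_cvg x))// mule_limn//.
    by congr (limn _); apply/funext => n; rewrite muleC.
  - by move=> n; rewrite /= lee_fin.
  - exact: nf.
congr (limn _); apply/funext => n; set phi := f_ n.
rewrite integralT_nnsfun sintegralE.
under [RHS]eq_integral => x _.
  rewrite fimfunE -fsumEFin// ge0_mule_fsuml; last by move=> r; exact: nnfun_muleindic_ge0.
  over.
rewrite ge0_integral_fsum//; last 2 first.
- move=> r; apply: emeasurable_funM => //.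
  by apply/measurable_EFinP; apply: measurable_funM.
- by move=> r x _; rewrite mule_ge0// nnfun_muleindic_ge0.
apply: eq_fsbigr => r; rewrite inE => -[x0 _ rx].
have r0 : 0 <= r%:E by rewrite lee_fin -rx.
have mA : measurable (phi @^-1` [set r]) by [].
under eq_integral do rewrite EFinM -muleA.
rewrite ge0_integralZl//; last 2 first.
- by apply: emeasurable_funM => //; apply/measurable_EFinP; exact: measurable_indic.
- by move=> x _; rewrite mule_ge0// lee_fin.
congr (_ * _); rewrite -[LHS]/(\int[m]_(x in phi @^-1` [set r]) g x) [LHS]integral_mkcond.
apply: eq_integral => x _.
by rewrite patchE indicE; case: ifPn; rewrite ?mul1e ?mul0e.
Qed.
End density.

End lebesgue_measurable.

Theorem corollary1p1 (R : realType) (N : nat) (theta gamma p : R)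
    (hN : (1 <= N)%N)
    (htheta : 0 < theta <= 2)
    (hgamma : 0 < gamma < Num.min theta N%:R)
    (hp : 1 + (theta - gamma) / N%:R < p)
    (hgp : theta < 2 -> gamma < theta * (p - 1)) :
  exists2 c : R, 0 < c &
    forall mu : eucl R N -> \bar R,
      completed_measurable_fun (lebesgue_eucl N : set (eucl R N) -> \bar R) setT mu ->
      (forall x, (0 <= mu x <= c%:E * norm_npow ((theta - gamma) / (p - 1)) x)%E) ->
      exists2 T : \bar R, (0 < T)%E &
        exists u : eucl R N * measurableTypeR R -> \bar R,
          is_solution theta gamma p (density_measure mu) T u.
Proof.
move: hgamma; rewrite lt_min => /and3P[g0 gth gN].
have N0 : 0 < N%:R :> R by rewrite ltr0n.
have p1 : 1 < p.
  by apply: lt_trans hp; rewrite ltrDl divr_gt0// subr_gt0.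
have aN : (theta - gamma) / (p - 1) < N%:R.
  by rewrite ltr_pdivrMr ?subr_gt0// mulrC -ltr_pdivrMr// ltrBrDl.
have g0th : 0 < gamma < theta by rewrite g0.
have [c c0 hc] := mild_solution_exists htheta g0th gN p1 aN.
exists c => // mu mmu hmu; exists +oo%E => //.
have mu0 x : (0 <= mu x)%E by case/andP: (hmu x).
(* The datum is replaced by a Borel minorant equal to it off a null set: this gives the same measure
   and obeys the same pointwise bound. *)
have [m [Z [mm mZ Z0 mle mE]]] := completed_measurable_fun_borel mmu mu0.
have m0 x : (0 <= m x)%E by case/andP: (mle x).
have dE : density_measure mu = density_measure m.
  by apply/funext => A; exact: (ge0_integral_ae_eq A mu0 m0 mZ Z0 mE).
have mc x : (0 <= m x <= c%:E * npow ((theta - gamma) / (p - 1)) (eucl_norm x))%E.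
  by rewrite m0 /=; case/andP: (mle x) => _ /le_trans -> //; case/andP: (hmu x).
have [u [mu_ u0 hu]] := hc m mm mc.
exists u; split.
- move=> mD Y mY; apply: sub_sigma_algebra.
  exists (space_time +oo `&` u @^-1` Y); last first.
    by exists set0; [exact: negligible_set0|rewrite setU0].
  apply: measurableI; last by rewrite -[X in measurable X]setTI; exact: mu_.
  rewrite (_ : space_time +oo = snd @^-1` `]0, +oo[%classic); last first.
    apply/seteqP; split => -[x t]; rewrite /space_time /= in_itv /= andbT; first by case.
    by move=> t0; split => //; exact: ltry.
  by rewrite -[X in measurable X]setTI; exact: measurable_snd.
- by move=> z _; exact: u0.
- apply: aeW => -[x t] xt; have t0 : 0 < t by case: xt.
  have [ufin uE] := hu x t t0; split => //.
  rewrite {1}uE dE; congr (_ + _)%E.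
    rewrite -[RHS]/(\int[fun A => \int[lebesgue_eucl N]_(y in A) m y]_y
      (heat_kernel theta (eucl_sub x y) t)%:E)%E.
    rewrite ge0_integral_density//.
    + by apply: eq_integral => y _; rewrite /causal_kernel t0.
    + apply/measurable_EFinP.
      by apply: (measurableT_comp (@measurable_heat_kernel R N theta)
        (measurable_fun_pair (measurable_eucl_sub _ _) (measurable_cst t))).
    + by move=> y; have := causal_kernel_ge0 (eucl_sub x y) t htheta; rewrite /causal_kernel t0.
  apply: eq_integral => s; rewrite inE /= in_itv /= => /andP[s0 st].
  by apply: eq_integral => y _; rewrite /causal_kernel subr_gt0 st muleA.
Qed.
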